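(* Let $k$ be an algebraically closed field of characteristic zero and let $p$ be an odd prime. The group $\mathrm{H}^2_\ell(\mathbb{Z}/p\wr\mathbb{Z}/p)$ is an elementary abelian $p$-group of rank $(p-1)/2$.
   Context: $\mathbb{Z}/p\wr\mathbb{Z}/p$ is the wreath product, i.e. the semi-direct product $\mathbb{F}_p[C]\rtimes C$ with $C$ cyclic of order $p$ acting by left multiplication on the additive group of $\mathbb{F}_p[C]$. For a finite group $G$, $k[G]$ is the group algebra with coproduct $\Delta(g)=g\otimes g$ for $g\in G$. A twist on $k[G]$ is an invertible element $F\in k[G]\otimes k[G]$ with $(F\otimes 1)(\Delta\otimes\mathrm{id})(F)=(1\otimes F)(\mathrm{id}\otimes\Delta)(F)$. It is invariant if $\Delta(a)F=F\Delta(a)$ for all $a\in k[G]$. Invariant twists form a group $Z^2$ under multiplication. For $a$ in the group $A^1$ of invertible central elements of $k[G]$ put $\delta^1(a)=(a\otimes a)\Delta(a^{-1})$; $\delta^1$ is a homomorphism onto a central subgroup of $Z^2$, and $\mathrm{H}^2_\ell(G)=Z^2/\delta^1(A^1)$. *)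

(* Defs.v *)
From HB Require Import structures.
From mathcomp Require Import all_boot all_order all_algebra.
From mathcomp Require Import all_fingroup all_solvable all_field.
From mathcomp Require Import boolp generic_quotient.

Set Implicit Arguments.
Unset Strict Implicit.
Unset Printing Implicit Defensive.

Import GRing.Theory.
Local Open Scope ring_scope.

(* The group algebra K[G]: a function u stands for the sum of the u(g) g.
   The codomain is K^o so that the finite-dimensional K-module structure of the
   function space is found; the product is convolution, not pointwise. *)
Definition galg (K : fieldType) (G : finGroupType) : Type := {ffun G -> K^o}.

Section GroupAlgebra.
Variables (K : fieldType) (G : finGroupType).
Implicit Types (g h : G) (u v w : galg K G).

HB.instance Definition _ := Vector.copy (galg K G) {ffun G -> K^o}.

Definition gelt g : galg K G := [ffun x => (x == g)%:R].

Definition gmul u v : galg K G :=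
  [ffun x => \sum_y u y * v (y^-1 * x)%g].

Lemma gaddE u v x : (u + v) x = u x + v x. Proof. exact: ffunE. Qed.
Lemma gscaleE (c : K) u x : (c *: u) x = c * u x. Proof. exact: ffunE. Qed.
Lemma gzeroE x : (0 : galg K G) x = 0. Proof. exact: ffunE. Qed.

Lemma gmulA : associative gmul.
Proof.
move=> u v w; apply/ffunP=> x; rewrite !ffunE.
under eq_bigr => y _ do rewrite ffunE mulr_sumr.
under [RHS]eq_bigr => z _ do rewrite ffunE mulr_suml.
rewrite [RHS]exchange_big /=; apply: eq_bigr => y _.
rewrite (reindex_inj (mulgI y^-1%g)) /=; apply: eq_bigr => z _.
by rewrite mulrA invMg invgK mulgA -(mulgA _ y) mulgV mulg1.
Qed.

Lemma gmul1 : left_id (gelt 1%g) gmul.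
Proof.
move=> u; apply/ffunP=> x; rewrite ffunE (bigD1 1%g) //= ffunE eqxx mul1r.
rewrite invg1 mul1g big1 ?addr0 // => y /negPf ne.
by rewrite ffunE ne mul0r.
Qed.

Lemma gmulr1 : right_id (gelt 1%g) gmul.
Proof.
move=> u; apply/ffunP=> x; rewrite ffunE (bigD1 x) //= ffunE mulVg eqxx mulr1.
rewrite big1 ?addr0 // => y ne.
by rewrite ffunE -eq_mulVg1 (negPf ne) mulr0.
Qed.

Lemma gmulDl : left_distributive gmul +%R.
Proof.
move=> u v w; apply/ffunP=> x; rewrite gaddE !ffunE -big_split /=.
by apply: eq_bigr => y _; rewrite gaddE mulrDl.
Qed.

Lemma gmulDr : right_distributive gmul +%R.
Proof.
move=> u v w; apply/ffunP=> x; rewrite gaddE !ffunE -big_split /=.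
by apply: eq_bigr => y _; rewrite gaddE mulrDr.
Qed.

Lemma gelt1_neq0 : gelt 1%g != 0.
Proof. by apply/eqP=> /ffunP/(_ 1%g)/eqP; rewrite gzeroE ffunE eqxx oner_eq0. Qed.

HB.instance Definition _ := GRing.Zmodule_isNzRing.Build (galg K G)
  gmulA gmul1 gmulr1 gmulDl gmulDr gelt1_neq0.

Lemma gscalerAl (c : K) u v : c *: (u * v) = (c *: u) * v.
Proof.
apply/ffunP=> x; rewrite gscaleE !ffunE mulr_sumr.
by apply: eq_bigr => y _; rewrite gscaleE mulrA.
Qed.

HB.instance Definition _ := GRing.Lmodule_isLalgebra.Build K (galg K G)
  gscalerAl.

Lemma gscalerAr (c : K) u v : c *: (u * v) = u * (c *: v).
Proof.
apply/ffunP=> x; rewrite gscaleE !ffunE mulr_sumr.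
by apply: eq_bigr => y _; rewrite gscaleE mulrCA.
Qed.

HB.instance Definition _ := GRing.Lalgebra_isAlgebra.Build K (galg K G)
  gscalerAr.

HB.instance Definition _ := Algebra_isFalgebra.Build K (galg K G).

End GroupAlgebra.

Section FiniteGroupAlgebra.
Variables (K : finFieldType) (G : finGroupType).
HB.instance Definition _ := Finite.copy (galg K G) {ffun G -> K}.
HB.instance Definition _ := [finGroupMixin of galg K G for +%R].
End FiniteGroupAlgebra.

Section LinearExtension.
Variables (K : fieldType) (G : finGroupType).
Implicit Types (g h : G) (u v : galg K G).

Lemma gelt_sum u : u = \sum_g u g *: gelt K g.
Proof.
apply/ffunP=> x; rewrite sum_ffunE (bigD1 x) //= big1 ?addr0 => [|y ne].
  by rewrite gscaleE ffunE eqxx mulr1.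
by rewrite gscaleE ffunE eq_sym (negPf ne) mulr0.
Qed.

Lemma geltM g h : gelt K (g * h)%g = gelt K g * gelt K h.
Proof.
apply/ffunP=> x; rewrite !ffunE (bigD1 g) //= !ffunE eqxx mul1r.
rewrite big1 ?addr0 => [|y /negPf ne]; last by rewrite ffunE ne mul0r.
by rewrite -(inj_eq (mulgI g^-1%g)) mulKg.
Qed.

Lemma gmul_sum u v :
  u * v = \sum_g \sum_h (u g * v h) *: gelt K (g * h)%g.
Proof.
rewrite {1}(gelt_sum u) {1}(gelt_sum v) mulr_suml; apply: eq_bigr => g _.
rewrite mulr_sumr; apply: eq_bigr => h _.
by rewrite geltM -scalerAl -scalerAr scalerA.
Qed.

Variable A : algType K.
Implicit Type f : G -> A.

Definition glin f u : A := \sum_g u g *: f g.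

Lemma glin_gelt f g : glin f (gelt K g) = f g.
Proof.
rewrite /glin (bigD1 g) //= big1 ?addr0 => [|h /negPf ne].
  by rewrite ffunE eqxx scale1r.
by rewrite ffunE ne scale0r.
Qed.

Lemma glin_linear f : linear (glin f).
Proof.
move=> c u v; rewrite /glin scaler_sumr -big_split; apply: eq_bigr => g _ /=.
by rewrite gaddE gscaleE scalerDl scalerA.
Qed.
HB.instance Definition _ f :=
  GRing.isLinear.Build K (galg K G) A _ (glin f) (glin_linear f).

Lemma glinZ f c u : glin f (c *: u) = c *: glin f u.
Proof. exact: linearZ. Qed.

Lemma glin_sum f (I : finType) (E : I -> galg K G) :
  glin f (\sum_i E i) = \sum_i glin f (E i).
Proof. exact: raddf_sum. Qed.

Lemma glinM f : {morph f : g h / (g * h)%g >-> g * h} -> {morph glin f : u v / u * v}.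
Proof.
move=> fM u v; rewrite gmul_sum glin_sum [RHS]mulr_suml.
apply: eq_bigr => g _; rewrite glin_sum mulr_sumr; apply: eq_bigr => h _.
by rewrite glinZ glin_gelt fM -scalerAl -scalerAr scalerA.
Qed.

End LinearExtension.

(* K[G] (x) K[H] is represented by K[G x H], g (x) h being the basis element
   (g, h); likewise for triple tensor products, bracketed to the left. *)
Section Tensor.
Variables (K : fieldType) (G H : finGroupType).

Definition gtens (u : galg K G) (v : galg K H) : galg K (G * H)%type :=
  [ffun x => u x.1 * v x.2].

End Tensor.

Notation "u ⊗ v" := (gtens u v) (at level 39, left associativity) : ring_scope.

Section TensorTheory.
Variables (K : fieldType).

Lemma gtens_gelt (G H : finGroupType) (g : G) (h : H) :
  gelt K g ⊗ gelt K h = gelt K (g, h).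
Proof. by apply/ffunP=> -[x y]; rewrite !ffunE xpair_eqE mulr_natl mulrb; case: eqP. Qed.

Lemma gtens1 (G H : finGroupType) : 1 ⊗ 1 = 1 :> galg K (G * H)%type.
Proof. exact: gtens_gelt. Qed.

Lemma gtensM (G H : finGroupType) (u u' : galg K G) (v v' : galg K H) :
  (u ⊗ v) * (u' ⊗ v') = (u * u') ⊗ (v * v').
Proof.
apply/ffunP=> x; rewrite !ffunE big_distrlr /= pair_big /=.
by apply: eq_bigr => -[y z] _; rewrite !ffunE /= mulrACA.
Qed.

Lemma gtens_unit (G H : finGroupType) (u : galg K G) (v : galg K H) :
  u \is a GRing.unit -> v \is a GRing.unit -> u ⊗ v \is a GRing.unit.
Proof.
move=> Uu Uv; apply/unitrP; exists (u^-1 ⊗ v^-1).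
by rewrite !gtensM !mulVr // !divrr // gtens1.
Qed.

Lemma gtensV (G H : finGroupType) (u : galg K G) (v : galg K H) :
  u \is a GRing.unit -> v \is a GRing.unit -> (u ⊗ v)^-1 = u^-1 ⊗ v^-1.
Proof.
move=> Uu Uv; apply: (mulrI (gtens_unit Uu Uv)).
by rewrite divrr ?gtens_unit // gtensM !divrr // gtens1.
Qed.

Variables (G H G' H' : finGroupType).

Definition gtensmap (f : galg K G -> galg K G') (f' : galg K H -> galg K H')
    (F : galg K (G * H)%type) : galg K (G' * H')%type :=
  \sum_x F x *: (f (gelt K x.1) ⊗ f' (gelt K x.2)).

Definition gtensassoc (J : finGroupType) (F : galg K (G * (H * J))%type) :
    galg K (G * H * J)%type :=
  [ffun x => F (x.1.1, (x.1.2, x.2))].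

End TensorTheory.

Lemma morph_unit (A B : unitRingType) (f : A -> B) u : f 1 = 1 ->
  {morph f : x y / x * y} -> u \is a GRing.unit ->
  f u \is a GRing.unit /\ f u^-1 = (f u)^-1.
Proof.
move=> f1 fM Ua; have Ufa : f u \is a GRing.unit.
  by apply/unitrP; exists (f u^-1); rewrite -!fM mulVr ?divrr ?f1.
by split=> //; apply: (mulrI Ufa); rewrite -fM !divrr ?f1.
Qed.

Lemma gcenterP (K : fieldType) (G : finGroupType) (a : galg K G) :
  reflect (forall b, a * b = b * a) (a \in 'Z(fullv)%VS).
Proof.
rewrite memv_cap memvf /=.
apply: (iffP idP) => [/centvP ac b | ac]; first by rewrite ac ?memvf.
by apply/centvP => b _; exact: ac.
Qed.

Section LazyCohomology.
Variables (K : fieldType) (G : finGroupType).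
Local Notation KG := (galg K G).
Local Notation KG2 := (galg K (G * G)%type).
Local Notation KG3 := (galg K (G * G * G)%type).
Implicit Types (a b : KG) (F : KG2).

Definition comul a : KG2 := \sum_g a g *: (gelt K g ⊗ gelt K g).

Definition comul_id F : KG3 := gtensmap comul idfun F.
Definition id_comul F : KG3 := gtensassoc (gtensmap idfun comul F).
Definition tens1r F : KG3 := F ⊗ 1.
Definition tens1l F : KG3 := gtensassoc (1 ⊗ F).

Definition twist F :=
  F \is a GRing.unit /\ tens1r F * comul_id F = tens1l F * id_comul F.

Definition invariant F := forall a, comul a * F = F * comul a.

Lemma comulE a : comul a = glin (fun g => gelt K (g, g)) a.
Proof. by apply: eq_bigr => g _; rewrite gtens_gelt. Qed.

Lemma comul_gelt g : comul (gelt K g) = gelt K (g, g).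
Proof. by rewrite comulE glin_gelt. Qed.

Lemma comul_idE F : comul_id F = glin (fun x => gelt K (x.1, x.1, x.2)) F.
Proof. by apply: eq_bigr => x _; rewrite comul_gelt gtens_gelt. Qed.

Lemma gtensassocE (J H : finGroupType) (v : galg K (G * (H * J))%type) :
  gtensassoc v = glin (fun x => gelt K (x.1, x.2.1, x.2.2)) v.
Proof.
apply/ffunP=> -[[x y] z]; rewrite sum_ffunE ffunE (bigD1 (x, (y, z))) //=.
rewrite gscaleE ffunE eqxx mulr1 big1 ?addr0 // => -[x' [y' z']] /=.
rewrite gscaleE ffunE /= !xpair_eqE -andbA => /negPf ne.
by rewrite eq_sym (eq_sym y) (eq_sym z) ne mulr0.
Qed.

Lemma id_comulE F : id_comul F = glin (fun x => gelt K (x.1, x.2, x.2)) F.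
Proof.
rewrite /id_comul gtensassocE glin_sum; apply: eq_bigr => x _.
by rewrite comul_gelt gtens_gelt glinZ glin_gelt.
Qed.

Lemma comulM : {morph comul : a b / a * b}.
Proof. by move=> a b; rewrite !comulE glinM // => g h; rewrite -geltM. Qed.

Lemma comul_idM : {morph comul_id : F F' / F * F'}.
Proof. by move=> F F'; rewrite !comul_idE glinM // => g h; rewrite -geltM. Qed.

Lemma id_comulM : {morph id_comul : F F' / F * F'}.
Proof. by move=> F F'; rewrite !id_comulE glinM // => g h; rewrite -geltM. Qed.

Lemma tens1rM : {morph tens1r : F F' / F * F'}.
Proof. by move=> F F'; rewrite /tens1r gtensM mulr1. Qed.

Lemma gtensassocM (J H : finGroupType) :
  {morph @gtensassoc K G J H : u v / u * v}.
Proof. by move=> u v; rewrite !gtensassocE glinM // => g h; rewrite -geltM. Qed.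

Lemma tens1lM : {morph tens1l : F F' / F * F'}.
Proof.
by move=> F F'; rewrite /tens1l -gtensassocM gtensM mulr1.
Qed.

Lemma comul1 : comul 1 = 1. Proof. exact: comul_gelt. Qed.
Lemma comul_id1 : comul_id 1 = 1.
Proof. by rewrite comul_idE; apply: glin_gelt. Qed.
Lemma id_comul1 : id_comul 1 = 1.
Proof. by rewrite id_comulE; apply: glin_gelt. Qed.
Lemma tens1r1 : tens1r 1 = 1. Proof. exact: gtens1. Qed.
Lemma tens1l1 : tens1l 1 = 1.
Proof. by rewrite /tens1l gtens1 gtensassocE; apply: glin_gelt. Qed.

Definition invtwist F := twist F /\ invariant F.

Lemma tens1r_comm F F' : invariant F' ->
  tens1r F' * comul_id F = comul_id F * tens1r F'.
Proof.
move=> iF'; rewrite /comul_id /gtensmap mulr_suml mulr_sumr.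
apply: eq_bigr => x _; rewrite -scalerAl -scalerAr !gtensM.
by rewrite iF' mul1r mulr1.
Qed.

Lemma tens1l_comm F F' : invariant F' ->
  tens1l F' * id_comul F = id_comul F * tens1l F'.
Proof.
move=> iF'; rewrite /id_comul /tens1l -!gtensassocM /gtensmap; congr gtensassoc.
rewrite mulr_suml mulr_sumr.
apply: eq_bigr => x _; rewrite -scalerAl -scalerAr !gtensM.
by rewrite iF' mul1r mulr1.
Qed.

Lemma invtwist1 : invtwist 1.
Proof.
split=> [|a]; last by rewrite mulr1 mul1r.
by split; rewrite ?unitr1 // tens1r1 tens1l1 comul_id1 id_comul1.
Qed.

Lemma invtwistM F F' : invtwist F -> invtwist F' -> invtwist (F * F').
Proof.
move=> [[UF tF] iF] [[UF' tF'] iF']; split=> [|a]; last first.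
  by rewrite mulrA iF -mulrA iF' mulrA.
split; first by rewrite unitrMl.
rewrite tens1rM tens1lM comul_idM id_comulM.
have swap (R : pzRingType) (x y z t : R) : y * z = z * y ->
    (x * y) * (z * t) = (x * z) * (y * t).
  by move=> yz; rewrite -!mulrA (mulrA y) yz !mulrA.
by rewrite (swap _ _ _ _ _ (tens1r_comm _ iF')) tF tF' swap ?tens1l_comm.
Qed.

Lemma invtwistV F : invtwist F -> invtwist F^-1.
Proof.
move=> [[UF tF] iF]; have iFV : invariant F^-1.
  by move=> a; apply: (mulIr UF); rewrite mulrVK // -mulrA iF mulKr.
split=> //; split; first by rewrite unitrV.
have [U1 e1] := morph_unit tens1r1 tens1rM UF.
have [U2 e2] := morph_unit tens1l1 tens1lM UF.
have [U3 e3] := morph_unit comul_id1 comul_idM UF.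
have [U4 e4] := morph_unit id_comul1 id_comulM UF.
rewrite (tens1r_comm _ iFV) (tens1l_comm _ iFV) e1 e2 e3 e4.
by rewrite -!invrM // tF.
Qed.

Record lazyZ2 := LazyZ2 { lazyZ2_val :> KG2; _ : `[< invtwist lazyZ2_val >] }.
HB.instance Definition _ := [isSub for lazyZ2_val].
HB.instance Definition _ := [Choice of lazyZ2 by <:].

Lemma lazyZ2P (F : lazyZ2) : invtwist F. Proof. exact/asboolP/(valP F). Qed.

Definition mkZ2 F (H : invtwist F) : lazyZ2 := LazyZ2 (asboolT H).

Let Z2one := mkZ2 invtwist1.
Let Z2mul (F F' : lazyZ2) := mkZ2 (invtwistM (lazyZ2P F) (lazyZ2P F')).
Let Z2inv (F : lazyZ2) := mkZ2 (invtwistV (lazyZ2P F)).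

Let Z2unit (F : lazyZ2) : (F : KG2) \is a GRing.unit.
Proof. by case: (lazyZ2P F) => -[]. Qed.
Let Z2mulA : associative Z2mul.
Proof. by move=> F1 F2 F3; apply/val_inj/mulrA. Qed.
Let Z2mul1 : left_id Z2one Z2mul.
Proof. by move=> F; apply/val_inj/mul1r. Qed.
Let Z2mulr1 : right_id Z2one Z2mul.
Proof. by move=> F; apply/val_inj/mulr1. Qed.
Let Z2mulV : left_inverse Z2one Z2inv Z2mul.
Proof. by move=> F; apply/val_inj/mulVr. Qed.
Let Z2mulrV : right_inverse Z2one Z2inv Z2mul.
Proof. by move=> F; apply/val_inj/divrr. Qed.

HB.instance Definition _ :=
  isGroup.Build lazyZ2 Z2mulA Z2mul1 Z2mulr1 Z2mulV Z2mulrV.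

Definition lazyA1 a := a \is a GRing.unit /\ a \in 'Z(fullv)%VS.

Definition delta1 a : KG2 := (a ⊗ a) * comul a^-1.

Lemma comul_id_tens a b : comul_id (a ⊗ b) = comul a ⊗ b.
Proof.
rewrite comul_idE; apply/ffunP=> -[gh l].
rewrite !ffunE /= /comul /glin !sum_ffunE mulr_suml.
rewrite (eq_bigr (fun x => a x.1 * b x.2 * ((x.1, x.1, x.2) == (gh, l))%:R)).
  rewrite -(pair_bigA _ (fun g h => a g * b h * ((g, g, h) == (gh, l))%:R)) /=.
  apply: eq_bigr => g _; rewrite (bigD1 l) //= big1 ?addr0 => [|h /negPf ne].
    by rewrite gscaleE gtens_gelt ffunE !xpair_eqE eqxx andbT mulrAC eq_sym.
  by rewrite xpair_eqE ne andbF mulr0.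
by move=> x _; rewrite gscaleE !ffunE eq_sym.
Qed.

Lemma id_comul_tens a b : id_comul (a ⊗ b) = gtensassoc (a ⊗ comul b).
Proof.
rewrite id_comulE; apply/ffunP=> -[[g h] l].
rewrite !ffunE /= /comul /glin !sum_ffunE mulr_sumr.
rewrite (eq_bigr (fun x => a x.1 * b x.2 * ((x.1, x.2, x.2) == (g, h, l))%:R)).
  rewrite -(pair_bigA _ (fun i j => a i * b j * ((i, j, j) == (g, h, l))%:R)) /=.
  rewrite exchange_big /=.
  apply: eq_bigr => j _; rewrite (bigD1 g) //= big1 ?addr0 => [|i /negPf ne].
    by rewrite gscaleE gtens_gelt ffunE !xpair_eqE eqxx mulrA eq_sym (eq_sym j l).
  by rewrite !xpair_eqE ne mulr0.
by move=> x _; rewrite gscaleE !ffunE eq_sym.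
Qed.

Lemma comul_coassoc a : comul_id (comul a) = id_comul (comul a).
Proof.
rewrite comul_idE id_comulE comulE /glin; rewrite -!/(glin _ _) !glin_sum.
by apply: eq_bigr => g _; rewrite !glinZ !glin_gelt.
Qed.

Lemma gtens_central a b : a \in 'Z(fullv)%VS -> b \in 'Z(fullv)%VS ->
  a ⊗ b \in 'Z(fullv)%VS.
Proof.
move=> /gcenterP ac /gcenterP bc; rewrite memv_cap memvf /=; apply/centvP=> X _.
rewrite (gelt_sum X) mulr_suml mulr_sumr; apply: eq_bigr => x _.
rewrite -scalerAl -scalerAr; congr (_ *: _); case: x => g h.
by rewrite -gtens_gelt !gtensM ac bc.
Qed.

Lemma lazyA1V a : lazyA1 a -> lazyA1 a^-1.
Proof.
move=> [Ua /gcenterP Za]; split; first by rewrite unitrV.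
by apply/gcenterP=> c; apply: (mulIr Ua); rewrite mulrVK // -mulrA -Za mulKr.
Qed.

Lemma delta1_invtwist a : lazyA1 a -> invtwist (delta1 a).
Proof.
move=> [Ua Za]; have [Uc cV] := morph_unit comul1 comulM Ua.
have Zaa := gtens_central Za Za.
split.
  split; first by rewrite unitrMl ?gtens_unit // cV unitrV.
  rewrite /delta1 tens1rM tens1lM comul_idM id_comulM.
  rewrite comul_id_tens id_comul_tens comul_coassoc !mulrA; congr (_ * _).
  rewrite -!mulrA /tens1r /tens1l -!gtensassocM !gtensM -!comulM mulVr // comul1.
  rewrite !mulr1 !mul1r.
  by apply/ffunP=> -[[g h] l]; rewrite !ffunE /= mulrA.
move=> b; move: Zaa; rewrite memv_cap memvf /= => /centvP Zaa.
rewrite /delta1 mulrA -Zaa ?memvf // -!mulrA -!comulM; congr (_ * comul _).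
by case: (lazyA1V (conj Ua Za)) => _ /gcenterP ->.
Qed.

Lemma lazyA1_1 : lazyA1 1.
Proof. by split; [exact: unitr1 | apply/gcenterP => b; rewrite mul1r mulr1]. Qed.

Lemma lazyA1M a b : lazyA1 a -> lazyA1 b -> lazyA1 (a * b).
Proof.
move=> [Ua /gcenterP Za] [Ub /gcenterP Zb]; split; first by rewrite unitrMl.
by apply/gcenterP=> c; rewrite -mulrA Zb mulrA Za mulrA.
Qed.

Lemma delta1_1 : delta1 1 = 1.
Proof. by rewrite /delta1 gtens1 invr1 comul1 mulr1. Qed.

Lemma delta1M a b : lazyA1 a -> lazyA1 b -> delta1 (a * b) = delta1 a * delta1 b.
Proof.
move=> [Ua Za] [Ub Zb]; have /gcenterP Z := Za.
move: (gtens_central Zb Zb); rewrite memv_cap memvf /= => /centvP Zbb.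
have /gcenterP ZV : a^-1 \in 'Z(fullv)%VS by case: (lazyA1V (conj Ua Za)).
rewrite /delta1 invrM // -ZV comulM -gtensM -!mulrA; congr (_ * _).
by rewrite !mulrA Zbb ?memvf.
Qed.

Lemma delta1_comm a F : lazyA1 a -> invariant F -> delta1 a * F = F * delta1 a.
Proof.
move=> [Ua Za] iF; rewrite /delta1 -mulrA iF !mulrA; congr (_ * _).
by move: (gtens_central Za Za) => /gcenterP.
Qed.

Definition lazyB2 : {pred lazyZ2} :=
  [pred F : lazyZ2 | `[< exists2 a, lazyA1 a & val F = delta1 a >]].

Lemma lazyB2_1 : (1%g : lazyZ2) \in lazyB2.
Proof.
by apply/asboolP; exists 1; [exact: lazyA1_1 | rewrite delta1_1].
Qed.

Lemma lazyB2M (F F' : lazyZ2) :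
  F \in lazyB2 -> F' \in lazyB2 -> (F * F')%g \in lazyB2.
Proof.
move=> /asboolP[a Aa dF] /asboolP[b Ab dF']; apply/asboolP.
by exists (a * b); [exact: lazyA1M | rewrite delta1M // -dF -dF'].
Qed.

Lemma lazyB2V (F : lazyZ2) : F \in lazyB2 -> (F^-1)%g \in lazyB2.
Proof.
move=> /asboolP[a Aa dF]; apply/asboolP; exists a^-1; first exact: lazyA1V.
have Ud : delta1 a \is a GRing.unit by case: (delta1_invtwist Aa) => -[].
rewrite /= dF; apply: (mulrI Ud); rewrite divrr // -delta1M ?divrr ?delta1_1 //.
  by case: Aa.
exact: lazyA1V.
Qed.

Lemma lazyB2_central (F F' : lazyZ2) : F \in lazyB2 -> (F * F' = F' * F)%g.
Proof.
move=> /asboolP[a Aa dF]; apply: val_inj; rewrite /= dF delta1_comm //.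
by case: (lazyZ2P F').
Qed.

(* lazyB2 is a central subgroup: left and right cosets coincide. *)
Definition lazyZ2_eqv (F F' : lazyZ2) := (F * F'^-1)%g \in lazyB2.

Lemma lazyZ2_eqv_is_equiv : equiv_class_of lazyZ2_eqv.
Proof.
split=> [F|F F'|F1 F2 F3 e12 e23]; rewrite /lazyZ2_eqv.
- by rewrite mulgV lazyB2_1.
- by apply/idP/idP => /lazyB2V; rewrite invgM invgK.
- by rewrite -(mulgKV F1 F2) -mulgA lazyB2M.
Qed.

Canonical lazyZ2_equiv := EquivRelPack lazyZ2_eqv_is_equiv.

Definition lazyH2 := {eq_quot lazyZ2_equiv}%qT.
HB.instance Definition _ := EqQuotient.on lazyH2.
HB.instance Definition _ := Choice.on lazyH2.

Local Open Scope quotient_scope.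

Lemma lazyH2P (F F' : lazyZ2) :
  reflect (F = F' %[mod lazyH2]) ((F * F'^-1)%g \in lazyB2).
Proof. by rewrite -[_ \in _]/(lazyZ2_equiv F F'); apply: eqmodP. Qed.

Definition lazyH2_one : lazyH2 := \pi_lazyH2 1%g.
Definition lazyH2_inv (x : lazyH2) : lazyH2 := \pi_lazyH2 (repr x)^-1%g.
Definition lazyH2_mul (x y : lazyH2) : lazyH2 := \pi_lazyH2 (repr x * repr y)%g.

Lemma pi_lazyH2_inv (F : lazyZ2) : lazyH2_inv (\pi_lazyH2 F) = \pi_lazyH2 F^-1%g.
Proof.
apply/lazyH2P; rewrite invgK.
have /lazyH2P : F = repr (\pi_lazyH2 F) %[mod lazyH2] by rewrite reprK.
set r := repr _ => B; have e := lazyB2_central r^-1%g B.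
by rewrite -(mulgKV r (r^-1 * F)%g) -(mulgA r^-1%g) -e mulgKV.
Qed.

Lemma pi_lazyH2_mul (F F' : lazyZ2) : lazyH2_mul (\pi_lazyH2 F) (\pi_lazyH2 F') = \pi_lazyH2 (F * F')%g.
Proof.
apply/lazyH2P.
have /lazyH2P : repr (\pi_lazyH2 F) = F %[mod lazyH2] by rewrite reprK.
have /lazyH2P : repr (\pi_lazyH2 F') = F' %[mod lazyH2] by rewrite reprK.
set r := repr _; set r' := repr _ => Br' Br.
rewrite invgM -mulgA (mulgA r) (lazyB2_central _ Br') mulgA.
exact: lazyB2M.
Qed.

Lemma lazyH2W (x : lazyH2) : exists F : lazyZ2, x = \pi_lazyH2 F.
Proof. by exists (repr x); rewrite reprK. Qed.

Let H2mulA : associative lazyH2_mul.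
Proof.
move=> x y z; have [X ->] := lazyH2W x; have [Y ->] := lazyH2W y.
by have [Z ->] := lazyH2W z; rewrite !pi_lazyH2_mul mulgA.
Qed.
Let H2mul1 : left_id lazyH2_one lazyH2_mul.
Proof. by move=> x; have [X ->] := lazyH2W x; rewrite pi_lazyH2_mul mul1g. Qed.
Let H2mulr1 : right_id lazyH2_one lazyH2_mul.
Proof. by move=> x; have [X ->] := lazyH2W x; rewrite pi_lazyH2_mul mulg1. Qed.
Let H2mulV : left_inverse lazyH2_one lazyH2_inv lazyH2_mul.
Proof. by move=> x; have [X ->] := lazyH2W x; rewrite pi_lazyH2_inv pi_lazyH2_mul mulVg. Qed.
Let H2mulrV : right_inverse lazyH2_one lazyH2_inv lazyH2_mul.
Proof. by move=> x; have [X ->] := lazyH2W x; rewrite pi_lazyH2_inv pi_lazyH2_mul mulgV. Qed.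

HB.instance Definition _ :=
  isGroup.Build lazyH2 H2mulA H2mul1 H2mulr1 H2mulV H2mulrV.

End LazyCohomology.

Section WreathProduct.
Variables (K : finFieldType) (C : finGroupType).

(* MathComp actions are right actions: c acts by left multiplication by c^-1,
   so that in the semidirect product conjugation by c, x |-> c x c^-1, is left
   multiplication by c. *)
Definition translate (x : galg K C) (c : C) : galg K C := gelt K c^-1 * x.

Lemma translate_is_action : is_action [set: C] translate.
Proof.
split=> [c x y /(congr1 (GRing.mul (gelt K c)))|x b c _ _].
  by rewrite /translate !mulrA -geltM mulgV !mul1r.
by rewrite /translate invMg geltM mulrA.
Qed.

Definition translate_action := Action translate_is_action.

Lemma translate_is_groupAction :
  is_groupAction [set: galg K C] translate_action.
Proof.
move=> c _; rewrite inE; apply/andP; split.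
  by apply/subsetP=> x; rewrite inE.
by apply/morphicP=> x y _ _; rewrite !actpermE /= /translate mulrDr.
Qed.

Definition translate_groupAction := GroupAction translate_is_groupAction.

Definition wreath := sdprod_by translate_groupAction.
HB.instance Definition _ := FinGroup.on wreath.

End WreathProduct.

Definition elementary_abelian_of_rank (p r : nat) (H : groupType) :=
  exists (E : finGroupType) (f : {multiplicative H -> E}),
    [/\ bijective f, p.-abelem [set: E] & 'r([set: E]) = r]%g.

(* Main.v *)
(* Let F be an invariant twist on k[G] and R = F21 F^-1.  The hexagon identities
   make the rows of R commuting idempotents spanning a subcoalgebra, so R lives
   on pairwise commuting elements; invariance makes this set stable under
   conjugation, and for G = F_p[C] x| C with p odd it must lie in V = F_p[C].
   Under the Fourier transform on V, R becomes a C-invariant alternating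
   bicharacter, i.e. zeta^n with n(e_c, e_d) = nu(d - c) and nu : Z/p ->
     F_p odd.
   Multiplying F by the bicharacter with exponent n/2 gives a symmetric twist.
   A symmetric twist F satisfies F Delta(a) = a (x) a for some a != 0, a common
   eigenvector of the commuting operators a |-> (delta_g (x) id)(F Delta(a));
     such
   an a is invertible and conjugation by a is a class-preserving automorphism
   of G, hence inner, so a can be taken central and F = delta1 a.  Thus H^2 is
   the group of odd functions nu; a nonzero nu is not a coboundary since
   coboundaries are symmetric. *)
Require Import Defs.
From HB Require Import structures.
From mathcomp Require Import all_boot all_algebra all_fingroup.
From mathcomp Require Import all_solvable all_field mxabelem.
From mathcomp Require Import boolp generic_quotient zify.

Set Implicit Arguments.
Unset Strict Implicit.
Unset Printing Implicit Defensive.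

Import GRing.Theory.
Local Open Scope ring_scope.

(** * Pushforwards and the hexagon identities *)

Section Pushforward.
Variable K : fieldType.
Implicit Types G H J : finGroupType.

(** The linear extension of a map of sets. Coproducts on one leg, embeddings of legs and
    permutations of legs are all pushforwards along group homomorphisms, so identities between them
    reduce to composing maps. *)
Definition gpush G H (phi : G -> H) (u : galg K G) : galg K H :=
  glin (fun g => gelt K (phi g)) u.

HB.instance Definition _ G H (phi : G -> H) :=
  GRing.Linear.copy (gpush phi) (glin (fun g => gelt K (phi g))).

Lemma gpush_gelt G H (phi : G -> H) g : gpush phi (gelt K g) = gelt K (phi g).
Proof. exact: glin_gelt. Qed.

Lemma gpushM G H (phi : G -> H) : {morph phi : g h / (g * h)%g} ->
  {morph gpush phi : u v / u * v}.
Proof. by move=> phiM; apply: glinM => g h; rewrite phiM geltM. Qed.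

Lemma gpush1 G H (phi : G -> H) : phi 1%g = 1%g -> gpush phi 1 = 1.
Proof. by move=> phi1; rewrite [LHS]gpush_gelt phi1. Qed.

Lemma eq_gpush G H (phi psi : G -> H) : phi =1 psi -> gpush phi =1 gpush psi.
Proof. by move=> e u; apply: eq_bigr => g _; rewrite e. Qed.

Lemma gpush_comp G H J (psi : H -> J) (phi : G -> H) u :
  gpush psi (gpush phi u) = gpush (psi \o phi) u.
Proof.
rewrite {1}[gpush phi u]/gpush /glin linear_sum; apply: eq_bigr => g _.
by rewrite linearZ /= gpush_gelt.
Qed.

Lemma gpushE G H (phi : G -> H) u h :
  gpush phi u h = \sum_(g | phi g == h) u g.
Proof.
rewrite sum_ffunE [RHS]big_mkcond; apply: eq_bigr => g _.
by rewrite gscaleE ffunE mulr_natr eq_sym mulrb.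
Qed.

Lemma gpush_injE G H (phi : G -> H) u g :
  injective phi -> gpush phi u (phi g) = u g.
Proof.
move=> phiI; rewrite gpushE (eq_bigl (pred1 g)) ?big_pred1_eq // => x.
by rewrite /= (inj_eq phiI).
Qed.

Lemma gpush_notin G H (phi : G -> H) u h :
  (forall g, phi g != h) -> gpush phi u h = 0.
Proof. by move=> nh; rewrite gpushE big_pred0 // => g; exact: negPf (nh g). Qed.

Lemma gpush_unit G H (phi : G -> H) u : {morph phi : g h / (g * h)%g} ->
  u \is a GRing.unit -> gpush phi u \is a GRing.unit.
Proof.
move=> phiM Uu; have phi1 : phi 1%g = 1%g.
  by apply: (@mulgI _ (phi 1%g)); rewrite -phiM !mulg1.
by have [] := morph_unit (gpush1 phi1) (gpushM phiM) Uu.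
Qed.

End Pushforward.

Arguments gpush {K G H} phi u.

Section Hexagon.
Variables (K : fieldType) (G : finGroupType).
Local Notation KG2 := (galg K (G * G)%type).
Local Notation KG3 := (galg K (G * G * G)%type).
Implicit Types F : KG2.

Lemma comul_push (a : galg K G) : comul a = gpush (fun g => (g, g)) a.
Proof. exact: comulE. Qed.

Lemma comul_id_push F : comul_id F = gpush (fun x => (x.1, x.1, x.2)) F.
Proof. exact: comul_idE. Qed.

Lemma id_comul_push F : id_comul F = gpush (fun x => (x.1, x.2, x.2)) F.
Proof. exact: id_comulE. Qed.

Lemma tens1r_push F : tens1r F = gpush (fun x => (x.1, x.2, 1%g)) F.
Proof.
apply/ffunP=> -[[x y] z]; rewrite gpushE !ffunE /=.
have [-> | nz] := eqVneq z 1%g.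
  by rewrite mulr1 (big_pred1 (x, y)) // => -[a b];
    rewrite /= !xpair_eqE eqxx andbT.
by rewrite mulr0 big_pred0 // => -[a b]; rewrite xpair_eqE (eq_sym 1%g) (negPf
  nz) andbF.
Qed.

Lemma tens1l_push F : tens1l F = gpush (fun x => (1%g, x.1, x.2)) F.
Proof.
apply/ffunP=> -[[x y] z]; rewrite gpushE !ffunE /=.
have [-> | nz] := eqVneq x 1%g.
  by rewrite mul1r (big_pred1 (y, z)) // => -[a b]; rewrite /= !xpair_eqE eqxx.
by rewrite mul0r big_pred0 // => -[a b]; rewrite !xpair_eqE (eq_sym 1%g) (negPf
  nz).
Qed.

Definition gswap : KG2 -> KG2 := gpush (fun x => (x.2, x.1)).

Lemma gswapE F g h : gswap F (g, h) = F (h, g).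
Proof.
have swapI : injective (fun x : G * G => (x.2, x.1)) by move=> [? ?] [? ?] [->
  ->].
exact: (gpush_injE F (h, g) swapI).
Qed.

Lemma gswapM : {morph gswap : F F' / F * F'}.
Proof. exact: gpushM. Qed.

Lemma gswapK : involutive gswap.
Proof. by move=> F; apply/ffunP=> -[g h]; rewrite !gswapE. Qed.

Definition rmatrix F : KG2 := gswap F * F^-1.

Variable F : KG2.
Hypothesis iF : invtwist F.
Let R := rmatrix F.

Let UF : F \is a GRing.unit. Proof. by case: iF => -[]. Qed.

Lemma rmatrixK : R * F = gswap F.
Proof. by rewrite mulrVK. Qed.

Lemma rmatrix_swapr : R * gswap R = 1.
Proof.
have Us : gswap F \is a GRing.unit by apply: gpush_unit.
have s1 : gswap 1 = 1 by apply: gpush1.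
have [_ eV] := morph_unit s1 gswapM UF.
by rewrite /R /rmatrix gswapM gswapK eV mulrA mulrVK // divrr.
Qed.

Lemma rmatrix_swapl : gswap R * R = 1.
Proof.
by apply: (can_inj gswapK); rewrite gswapM gswapK rmatrix_swapr
  [RHS]gpush1.
Qed.

(** Apply [s] to the cocycle identity; taking for [s] a permutation of the three legs yields the
    permuted cocycle identities. *)
Lemma twist_push (s : G * G * G -> G * G * G) :
  {morph s : x y / (x * y)%g} ->
  gpush (fun x => s (x.1, x.2, 1%g)) F * gpush (fun x => s (x.1, x.1, x.2)) F =
  gpush (fun x => s (1%g, x.1, x.2)) F * gpush (fun x => s (x.1, x.2, x.2)) F.
Proof.
move=> sM; have [[_ tF] _] := iF; have := congr1 (gpush s) tF.
by rewrite !(gpushM sM) tens1r_push tens1l_push comul_id_push id_comul_push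
  !gpush_comp.
Qed.

(** Write Fij for [F] placed in legs i and j. After right multiplication by F12 and [comul_id F],
    invariance and [rmatrixK] turn the left side into F12 (Delta (x) id)(F21). Three permuted
    cocycle identities, alternating with F31 = R13 F13 and F32 = R23 F23, carry it to the right
    side. *)
Lemma rmatrix_comul_id : comul_id R =
  gpush (fun x => (x.1, 1%g, x.2)) R * gpush (fun x => (1%g, x.1, x.2)) R.
Proof.
have UF12 : (gpush (fun x => (x.1, x.2, 1%g)) F : KG3) \is a GRing.unit.
  by apply: gpush_unit => // -[a b] [c d]; congr (_, _, _); rewrite mulg1.
have UF12_3 : comul_id F \is a GRing.unit.
  by rewrite comul_id_push gpush_unit.
have := twist_push (s := id) (fun _ _ => erefl).
have := @twist_push (fun x => (x.1.2, x.2, x.1.1)) (fun _ _ => erefl).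
have := @twist_push (fun x => (x.1.1, x.2, x.1.2)) (fun _ _ => erefl).
rewrite /= -comul_id_push -tens1r_push -id_comul_push => e132 e231 e123.
have i12 : tens1r F * comul_id R = comul_id R * tens1r F by apply: tens1r_comm;
  case: iF.
apply: (mulIr UF12); rewrite -tens1r_push -i12.
apply: (mulIr UF12_3); rewrite -!mulrA -comul_idM rmatrixK.
have -> : comul_id (gswap F) = gpush (fun x => (x.2, x.2, x.1)) F.
  by rewrite comul_id_push gpush_comp.
rewrite -e231.
have push_swap (phi : G * G -> G * G * G) : {morph phi : x y / (x * y)%g} ->
    gpush (fun x => phi (x.2, x.1)) F = gpush phi R * gpush phi F.
  by move=> phiM; rewrite -(gpushM phiM) rmatrixK gpush_comp.
rewrite (push_swap (fun x => (x.1, 1%g, x.2))); last first.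
  by move=> [a b] [c d]; congr (_, _, _); rewrite mulg1.
rewrite -!mulrA e132 (push_swap (fun x => (1%g, x.1, x.2))); last first.
  by move=> [a b] [c d]; congr (_, _, _); rewrite mulg1.
by rewrite -!mulrA -e123.
Qed.

(** The inverse of [R] is [gswap R]. Rotating the legs of the first hexagon identity expresses (id
    (x) Delta)([gswap R]) as R21 R31, and taking inverses gives the second identity. *)
Lemma rmatrix_id_comul : id_comul R =
  gpush (fun x => (x.1, 1%g, x.2)) R * gpush (fun x => (x.1, x.2, 1%g)) R.
Proof.
have sM : {morph (fun x : G * G * G => (x.2, x.1.1, x.1.2)) :
  x y / (x * y)%g} by [].
have := congr1 (gpush (fun x => (x.2, x.1.1, x.1.2))) rmatrix_comul_id.
rewrite (gpushM sM) comul_id_push !gpush_comp => e.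
have push_swap (phi : G * G -> G * G * G) : {morph phi : x y / (x * y)%g} ->
    gpush phi R * gpush (fun x => phi (x.2, x.1)) R = 1.
  move=> phiM; rewrite -[X in _ * X](gpush_comp phi) -(gpushM phiM)
    rmatrix_swapr.
  by rewrite gpush1 //; apply: (mulgI (phi 1%g)); rewrite -phiM !mulg1.
have UR : R \is a GRing.unit.
  by apply/unitrP; exists (gswap R); rewrite rmatrix_swapl rmatrix_swapr.
have Ud : (gpush (fun x => (x.2, x.1, x.1)) R : KG3) \is a GRing.unit.
  by rewrite gpush_unit.
apply: (mulIr Ud); rewrite id_comul_push push_swap //.
rewrite [X in _ = _ * X]e -mulrA (mulrA _ _ (gpush _ R)).
rewrite (push_swap (fun x => (x.1, x.2, 1%g))); last first.
  by move=> [a b] [c d]; congr (_, _, _); rewrite mulg1.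
rewrite mul1r push_swap // => -[a b] [c d]; congr (_, _, _); by rewrite mulg1.
Qed.

End Hexagon.

Arguments gswap {K G} F.

(** * Coefficients and support of the R-matrix *)

Section Coefficients.
Variable K : fieldType.

Lemma gelt_mulE (G : finGroupType) (a : G) (u : galg K G) z :
  (gelt K a * u) z = u (a^-1 * z)%g.
Proof.
rewrite ffunE (bigD1 a) //= ffunE eqxx mul1r.
by rewrite big1 ?addr0 // => x /negPf ne; rewrite ffunE ne mul0r.
Qed.

Lemma mul_geltE (G : finGroupType) (a : G) (u : galg K G) z :
  (u * gelt K a) z = u (z * a^-1)%g.
Proof.
rewrite ffunE (bigD1 (z * a^-1)%g) //= ffunE invMg invgK mulgKV eqxx mulr1.
rewrite big1 ?addr0 // => x ne; rewrite ffunE -(inj_eq (mulgI x)) mulKVg.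
by rewrite -(inj_eq (mulIg a^-1%g)) mulgK eq_sym (negPf ne) mulr0.
Qed.

Lemma gpush_mulE (G H : finGroupType) (phi : G -> H) (u : galg K G) v h :
  (gpush phi u * v) h = \sum_g u g * v ((phi g)^-1 * h)%g.
Proof.
rewrite mulr_suml sum_ffunE; apply: eq_bigr => g _.
by rewrite -scalerAl gscaleE gelt_mulE.
Qed.

Section Support.
Variable G : finGroupType.
Implicit Types r : G -> G -> K.

(* (Delta (x) id) R = R13 R23 and (id (x) Delta) R = R13 R12, in coordinates. *)
Definition left_character r := forall g g' h,
  (g == g')%:R * r g h = \sum_z r g z * r g' (z^-1 * h)%g.

Definition right_character r := forall g h h',
  (h == h')%:R * r g h = \sum_z r z h' * r (z^-1 * g)%g h.

Definition row_elt r g : galg K G := [ffun h => r g h].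

(** The first hexagon identity says exactly that the rows are orthogonal idempotents. *)
Lemma left_character_rowM r g g' : left_character r ->
  row_elt r g * row_elt r g' = (g == g')%:R *: row_elt r g.
Proof.
move=> rl; apply/ffunP=> z; rewrite gscaleE !ffunE rl; apply: eq_bigr => t _.
by rewrite !ffunE.
Qed.

(* The rows of r commute, and h is a combination of rows when r g h != 0. *)
Lemma support_commute r g h g' h' : left_character r -> right_character r ->
  r g h != 0 -> r g' h' != 0 -> commute h h'.
Proof.
move=> rl rr nz nz'; pose row := row_elt r.
have rowC x x' : row x * row x' = row x' * row x.
  by rewrite /row !left_character_rowM // eq_sym; case: eqP => [->|_];
    rewrite ?scale0r.
have rowE x y : r x y *: gelt K y = \sum_z r (z^-1 * x)%g y *: row z.
  apply/ffunP=> t; rewrite gscaleE sum_ffunE ffunE mulrC eq_sym rr.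
  by apply: eq_bigr => z _; rewrite gscaleE ffunE mulrC.
have : (r g h *: gelt K h) * (r g' h' *: gelt K h') =
       (r g' h' *: gelt K h') * (r g h *: gelt K h).
  rewrite !rowE; apply: commr_sum => z _; apply/esym/commr_sum => t _.
  by rewrite /GRing.comm -!scalerAl -!scalerAr rowC !scalerA mulrC.
rewrite -!scalerAl -!scalerAr !scalerA -!geltM (mulrC (r g' h')).
move/(scalerI (mulf_neq0 nz nz'))/ffunP/(_ (h * h')%g).
by rewrite !ffunE eqxx; case: (_ =P _) => // _ /eqP; rewrite oner_eq0.
Qed.

(** Transposition exchanges the two legs and with them the two conditions, so results on the second
    leg of [r] transfer to the first. *)
Lemma left_right_character r : left_character r ->
  right_character (fun g h => r h g).
Proof.
by move=> rl g h h'; rewrite -rl eq_sym; case: eqP => [->|];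
  rewrite ?mul0r.
Qed.

Lemma right_left_character r : right_character r ->
  left_character (fun g h => r h g).
Proof.
by move=> rr g g' h; rewrite -rr eq_sym; case: eqP => [->|];
  rewrite ?mul0r.
Qed.

End Support.

Variables (G : finGroupType) (F : galg K (G * G)%type).
Hypothesis iF : invtwist F.

Lemma rmatrix_left_character : left_character (fun g h => rmatrix F (g, h)).
Proof.
move=> g g' h; move: (rmatrix F) (rmatrix_comul_id iF) => R.
move=> /ffunP/(_ (g, g', h)); rewrite gpush_mulE comul_id_push gpushE => e.
transitivity (\sum_(x | (x.1, x.1, x.2) == (g, g', h)) R x).
  have [->|ne] := eqVneq g g'; last first.
    by rewrite mul0r big_pred0 // => -[a b]; rewrite !xpair_eqE;
      case: eqP => //= ->; rewrite (negPf ne).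
  rewrite mul1r (big_pred1 (g', h)) // => -[a b].
  by rewrite /= !xpair_eqE andbb.
rewrite e; transitivity (\sum_a \sum_b
    R (a, b) *
    gpush (fun x => (1%g, x.1, x.2)) R ((a, 1, b)^-1 * (g, g', h))%g).
  by rewrite pair_bigA; apply: eq_bigr => -[].
(* The second factor is supported on elements with trivial first leg, so only the terms with [a = g]
   survive. *)
rewrite (bigD1 g) //= [X in _ + X]big1 ?addr0 => [|a ne]; last first.
  apply: big1 => b _; rewrite gpush_notin ?mulr0 // => -[x y].
  by rewrite !xpair_eqE eq_sym -eq_mulVg1 (negPf ne).
apply: eq_bigr => b _; congr (_ * _); rewrite gpushE.
rewrite (big_pred1 (g', b^-1 * h)%g) //.
by move=> [x y]; rewrite /= !xpair_eqE /= mulVg eqxx invg1 mul1g.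
Qed.

Lemma rmatrix_right_character : right_character (fun g h => rmatrix F (g, h)).
Proof.
move=> g h h'; move: (rmatrix F) (rmatrix_id_comul iF) => R.
move=> /ffunP/(_ (g, h, h')); rewrite gpush_mulE id_comul_push gpushE => e.
transitivity (\sum_(x | (x.1, x.2, x.2) == (g, h, h')) R x).
  have [->|ne] := eqVneq h h'; last first.
    by rewrite mul0r big_pred0 // => -[a b]; rewrite !xpair_eqE -andbA;
      case: (b =P h) => [->|]; rewrite ?(negPf ne) !andbF.
  rewrite mul1r (big_pred1 (g, h')) // => -[a b].
  by rewrite /= !xpair_eqE -andbA andbb.
rewrite e; transitivity (\sum_a \sum_b
    R (a, b) *
    gpush (fun x => (x.1, x.2, 1%g)) R ((a, 1, b)^-1 * (g, h, h'))%g).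
  by rewrite pair_bigA; apply: eq_bigr => -[].
apply: eq_bigr => a _; rewrite (bigD1 h') //= [X in _ + X]big1 ?addr0 => [|b
  ne]; last first.
  rewrite gpush_notin ?mulr0 // => -[x y].
  by rewrite !xpair_eqE [X in _ && X]eq_sym -eq_mulVg1 (negPf ne) andbF.
congr (_ * _); rewrite gpushE (big_pred1 (a^-1 * g, h)%g) //.
by move=> [x y]; rewrite /= !xpair_eqE /= mulVg eqxx invg1 mul1g andbT.
Qed.

(** The coproduct of a group element is fixed by [gswap], so it commutes with [gswap F] as well as
    with [F], hence with [rmatrix F]. *)
Lemma rmatrix_conj g h x : rmatrix F (g ^ x, h ^ x)%g = rmatrix F (g, h).
Proof.
have [[UF _] iv] := iF.
have sV : gswap (comul (gelt K x)) = comul (gelt K x).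
  by rewrite comul_gelt /gswap gpush_gelt.
have /ffunP/(_ (g * x, h * x)%g) : comul (gelt K x) * rmatrix F = rmatrix F *
  comul (gelt K x).
  apply: (mulIr UF); rewrite -mulrA rmatrixK // -[RHS]mulrA iv [RHS]mulrA
    rmatrixK //.
  by have /(congr1 gswap) := iv (gelt K x); rewrite !gswapM sV.
rewrite comul_gelt gelt_mulE mul_geltE => e.
transitivity (rmatrix F ((x, x)^-1 * (g * x, h * x))%g); first by [].
by rewrite e; congr (rmatrix F (_, _)); rewrite /= mulgK.
Qed.

End Coefficients.

(** * Symmetric twists *)

Section CommonEigenvector.
Import VectorInternalTheory.
Variable k : closedFieldType.

(** By Cayley-Hamilton a nonzero [v] in [U] is killed by the product of the factors A - c over the
    roots c of the characteristic polynomial. When the factors are applied one at a time, the last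
    nonzero vector is an eigenvector, and it stays in the stable space [U]. *)
Lemma stable_eigenvector n (A U : 'M[k]_n) : U != 0 -> stablemx U A ->
  exists v : 'rV_n, [/\ v != 0, (v <= U)%MS & exists c, v *m A = c *: v].
Proof.
case: n A U => [|n] A U; first by rewrite [U]flatmx0 eqxx.
move=> /rowV0Pn[v vU nv] stU; have [rs def_p] := closed_field_poly_normal
  (char_poly A).
have: v *m horner_mx A (\prod_(c <- rs) ('X - c%:P)) = 0.
  have /monicP lc := char_poly_monic A; rewrite lc scale1r in def_p.
  by rewrite -def_p Cayley_Hamilton mulmx0.
elim: rs v vU nv {def_p} => [|c rs IHrs] v vU nv.
  by rewrite big_nil rmorph1 mulmx1 => v0; rewrite v0 eqxx in nv.
rewrite big_cons rmorphM -mulmxE mulmxA rmorphB /= horner_mx_X horner_mx_C.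
have [w0 _|nw /IHrs] := eqVneq (v *m (A - c%:M)) 0.
  exists v; split=> //; exists c; apply/eqP; rewrite -subr_eq0.
  by rewrite -mul_mx_scalar -mulmxBr w0.
apply=> //; rewrite mulmxBr mul_mx_scalar addmx_sub ?eqmx_opp ?scalemx_sub //.
exact: submx_trans (submxMr A vU) stU.
Qed.

(** Induction on the list: [U] is cut down to its intersection with an eigenspace of the first
    operator, which the others preserve because they commute with it. *)
Lemma common_stable_eigenvector n (As : seq 'M[k]_n) (U : 'M_n) :
  {in As &, forall A B, comm_mx A B} -> U != 0 ->
    {in As, forall A, stablemx U A} ->
  exists v : 'rV_n, [/\ v != 0, (v <= U)%MS &
    {in As, forall A, exists c, v *m A = c *: v}].
Proof.
elim: As U => [|A As IHAs] U comAs nU stU.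
  by have /rowV0Pn[v vU nv] := nU; exists v.
have [v [nv vU [c vA]]] := stable_eigenvector nU (stU A (mem_head _ _)).
pose W := (U :&: eigenspace A c)%MS.
have nW : W != 0.
  by apply/rowV0Pn; exists v => //; rewrite sub_capmx vU; apply/eigenspaceP.
have [||w [nw wW wAs]] := IHAs W _ nW.
- by move=> B C iB iC; apply: comAs; rewrite inE ?iB ?iC orbT.
- move=> B iB; rewrite sub_capmx.
  have iB' : B \in A :: As by rewrite inE iB orbT.
  rewrite (submx_trans _ (stU B iB')) ?submxMr ?capmxSl //=.
  have stE := comm_mx_stable_eigenspace c (comAs A B (mem_head _ _) iB').
  by rewrite (submx_trans _ stE) ?submxMr ?capmxSr.
move: wW; rewrite sub_capmx => /andP[wU /eigenspaceP wA].
exists w; split=> // B; rewrite inE => /predU1P[->|/wAs //]; by exists c.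
Qed.

Lemma commuting_eigenvector (V : vectType k) (I : finType) (T : I ->
  {linear V -> V}) (u : V) :
  (forall i j v, T i (T j v) = T j (T i v)) -> u != 0 ->
  exists2 v, v != 0 & exists c : I -> k, forall i, T i v = c i *: v.
Proof.
move=> TC nu; pose M i := lin1_mx (v2r \o T i \o r2v).
have ME i v : v2r v *m M i = v2r (T i v) by rewrite mul_rV_lin1 /= v2rK.
have MC i j : M i *m M j = M j *m M i.
  by apply/row_matrixP=> l; rewrite !rowE -(r2vK (delta_mx _ _)) !mulmxA !ME TC.
have [|||v [nv _ vM]] := @common_stable_eigenvector _ (codom M) 1%:M.
- by move=> _ _ /codomP[i ->] /codomP[j ->]; apply: MC.
- apply: contraNneq nu => e0; rewrite -(can_eq v2rK) linear0.
  by rewrite -[v2r u]mulmx1 e0 mulmx0.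
- by move=> A _; rewrite submx1.
exists (r2v v); first by rewrite -(can_eq r2vK) linear0 in nv *.
have /fin_all_exists[c vc] i : exists c, T i (r2v v) = c *: r2v v.
  have [c vc] := vM _ (codom_f M i); exists c.
  by apply: (can_inj v2rK); rewrite -ME r2vK vc linearZ /= r2vK.
by exists c.
Qed.

End CommonEigenvector.

(** * Slices of the tensor square and the operators they define *)

Section Slices.
Variables (K : fieldType) (G : finGroupType) (F : galg K (G * G)%type).
Implicit Types (a : galg K G) (X : galg K (G * G)%type).

Definition slice g X : galg K G := [ffun h => X (g, h)].

Lemma slice_is_linear g : linear (slice g).
Proof.
by move=> c X Y; apply/ffunP=> h; rewrite ffunE !gaddE !gscaleE !ffunE.
Qed.
HB.instance Definition _ g := GRing.isLinear.Build K _ _ _ _ (slice_is_linear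
  g).

Lemma comul_is_linear : linear (@comul K G).
Proof. by move=> c a b; rewrite !comul_push linearP. Qed.
HB.instance Definition _ := GRing.isLinear.Build K _ _ _ _ comul_is_linear.

Definition twist_slice g a := slice g (F * comul a).

Lemma twist_slice_is_linear g : linear (twist_slice g).
Proof.
by move=> c a b; rewrite /twist_slice linearP mulrDr -scalerAr linearP.
Qed.
HB.instance Definition _ g :=
  GRing.isLinear.Build K _ _ _ _ (twist_slice_is_linear g).

Lemma comul_coef a x y : comul a (x, y) = (x == y)%:R * a x.
Proof.
rewrite comul_push gpushE; have [<-|ne] := eqVneq x y.
  by rewrite mul1r (big_pred1 x) // => z; rewrite /= xpair_eqE andbb.
rewrite mul0r big_pred0 // => z; rewrite xpair_eqE.
by case: eqP => //= ->; rewrite (negPf ne).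
Qed.

Lemma id_comul_coef X x y z : id_comul X (x, y, z) = (y == z)%:R * X (x, y).
Proof.
rewrite id_comul_push gpushE; have [<-|ne] := eqVneq y z.
  rewrite mul1r (big_pred1 (x, y)) // => -[a b].
  by rewrite /= !xpair_eqE -andbA andbb.
rewrite mul0r big_pred0 // => -[a b]; rewrite !xpair_eqE -andbA.
by case: (b =P y) => [->|]; rewrite ?(negPf ne) !andbF.
Qed.

(** For [X = F * comul a] the right side is a composite of two operators [twist_slice], so such
    composites are read off from a single element of the triple tensor power. *)
Lemma tens1l_id_comul_slice X g g' h :
  (tens1l F * id_comul X) (g, g', h) = twist_slice g' (slice g X) h.
Proof.
rewrite tens1l_push gpush_mulE 2![RHS]ffunE; apply: eq_bigr => -[x y] _.
congr (_ * _).
transitivity (comul (slice g X) (x^-1 * g', y^-1 * h)%g); last by [].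
rewrite comul_coef [slice _ _ _]ffunE.
rewrite -id_comul_coef; congr (id_comul X (_, _, _)).
by rewrite /= invg1 mul1g.
Qed.

(** By the cocycle identity and coassociativity the composite is a coefficient of F12 (Delta (x)
    id)(F Delta(a)), which is unchanged by exchanging the first two legs when [F] is symmetric. *)
Lemma twist_slice_comm g g' a : twist F -> gswap F = F ->
  twist_slice g' (twist_slice g a) = twist_slice g (twist_slice g' a).
Proof.
move=> [_ tF] sF; apply/ffunP=> h; rewrite -!tens1l_id_comul_slice.
rewrite id_comulM mulrA -tF -mulrA -comul_coassoc -comul_idM.
pose s (x : G * G * G) := (x.1.2, x.1.1, x.2).
have sI : injective s by move=> [[? ?] ?] [[? ?] ?] [-> -> ->].
set Y := tens1r F * _; rewrite -[LHS](gpush_injE Y (g, g', h) sI).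
suff -> : gpush s Y = Y by []; rewrite gpushM //; congr (_ * _).
  by rewrite tens1r_push gpush_comp -[in RHS]sF /gswap gpush_comp.
by rewrite comul_id_push gpush_comp.
Qed.

Lemma coef_neq0 (v : galg K G) : v != 0 -> exists g, v g != 0.
Proof.
move=> nv; apply/existsP; apply: contraR nv => /existsPn v0.
by apply/eqP/ffunP=> h; rewrite gzeroE; apply/eqP; move: (v0 h); rewrite negbK.
Qed.

(** Left multiplication by [a] is injective, hence surjective in finite dimension. This gives
    [a * b = 1], and regularity applied to [b * a - 1] makes the inverse two-sided. *)
Lemma lreg_unit (a : galg K G) : (forall b, a * b = 0 -> b = 0) ->
  a \is a GRing.unit.
Proof.
move=> a_reg; have k0 : lker (amull a) == 0%VS.
  apply/lker0P=> u v; rewrite !lfunE /= => e; apply/eqP; rewrite -subr_eq0.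
  by apply/eqP/a_reg; rewrite mulrBr e subrr.
pose b := (amull a)^-1%VF 1.
have ab : a * b = 1 by have := lker0_lfunVK k0 1; rewrite lfunE.
apply/unitrP; exists b; split=> //; apply/eqP; rewrite -subr_eq0.
by apply/eqP/a_reg; rewrite mulrBr mulrA ab mul1r mulr1 subrr.
Qed.

Lemma tens_inj (u v : galg K G) : gswap (u ⊗ v) = u ⊗ v -> v != 0 ->
  exists c, u = c *: v.
Proof.
move=> /ffunP suv /coef_neq0[h nh].
exists (u h / v h); apply/ffunP=> g; rewrite gscaleE.
have := suv (h, g); rewrite gswapE !ffunE /= => e.
by apply: (mulIf nh); rewrite e mulrAC divfK.
Qed.

End Slices.

(** * Symmetric invariant twists are coboundaries *)

Section SymmetricTwist.
Variables (k : closedFieldType) (G : finGroupType) (F : galg k (G * G)%type).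
Hypotheses (tF : twist F) (sF : gswap F = F).

Lemma comul_inj : injective (@comul k G).
Proof.
by move=> a b /ffunP e; apply/ffunP=> g; have := e (g, g);
  rewrite !comul_coef eqxx !mul1r.
Qed.

(** A common eigenvector [a] of the slice operators satisfies F Delta(a) = l (x) a, with l the
    function of eigenvalues. Symmetry forces l = c a, where c is nonzero because F Delta(a) is, and
    rescaling [a] by c makes the two factors equal. *)
Lemma symmetric_twist_trivialization : exists2 a : galg k G,
  a \is a GRing.unit & F * comul a = a ⊗ a.
Proof.
have UF : F \is a GRing.unit by case: tF.
have n1 : (1 : galg k G) != 0 by apply: gelt1_neq0.
have [|a na [l la]] := @commuting_eigenvector _ _ _
    (fun g => twist_slice F g : {linear galg k G -> galg k G}) 1 _ n1.
  by move=> g g' a; apply: twist_slice_comm.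
have eF : F * comul a = [ffun g => l g] ⊗ a.
  apply/ffunP=> -[g h]; have /ffunP/(_ h) := la g.
  by rewrite gscaleE !ffunE.
have nF : F * comul a != 0.
  rewrite -(mulr0 F) (inj_eq (mulrI UF)) -(linear0 (@comul k G)).
  by rewrite (inj_eq comul_inj).
have [|c lE] := tens_inj _ na (u := [ffun g => l g]).
  by rewrite -eF gswapM sF comul_push /gswap gpush_comp.
have tensZl (x : k) u : (x *: a) ⊗ u = x *: (a ⊗ u).
  by apply/ffunP=> -[g h]; rewrite [RHS]gscaleE ![(_ ⊗ _) _]ffunE /= gscaleE
    mulrA.
have tensZr (x : k) u : u ⊗ (x *: a) = x *: (u ⊗ a).
  by apply/ffunP=> -[g h]; rewrite [RHS]gscaleE ![(_ ⊗ _) _]ffunE /= gscaleE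
    mulrCA.
have nc : c != 0 by apply: contraNneq nF => c0; rewrite eF lE c0 tensZl scale0r.
have naa : c *: a != 0 by rewrite scaler_eq0 negb_or nc.
have {}eF : F * comul (c *: a) = (c *: a) ⊗ (c *: a).
  by rewrite linearZ /= -scalerAr eF lE tensZr.
exists (c *: a) => //; move: (c *: a) naa eF => b nb eF.
(* If b u = 0, then F Delta(b) (u (x) 1) = b u (x) b = 0 and [F] cancels. The coefficient of
   Delta(b) (u (x) 1) at (g x, g) is b(g) u(x), so choosing g with b(g) nonzero kills u. *)
apply: lreg_unit => u bu0; have {}bu0 : comul b * (u ⊗ 1) = 0.
  by apply: (mulrI UF); rewrite mulrA eF gtensM bu0 mulr0; apply/ffunP=> x;
    rewrite ffunE !gzeroE mul0r.
have [g ng] := coef_neq0 nb; apply/ffunP=> x; rewrite gzeroE.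
have /ffunP/(_ (g * x, g)%g) := bu0; rewrite comul_push gpush_mulE gzeroE.
rewrite (bigD1 g) //= big1 ?addr0 => [|y ne].
  by move/eqP; rewrite !ffunE /= mulKg mulVg eqxx mulr1 mulf_eq0 (negPf ng) =>
    /eqP.
by rewrite !ffunE /= -eq_mulVg1 (negPf ne) !mulr0.
Qed.

(** The off-diagonal coefficients of [comul u] vanish, which confines [u] to a single group element;
    the diagonal one then forces the coefficient 1. *)
Lemma grouplike_gelt (u : galg k G) : u != 0 -> comul u = u ⊗ u ->
  exists g, u = gelt k g.
Proof.
move=> /coef_neq0[g ng] /ffunP du; exists g; apply/ffunP=> x.
have := du (x, g); rewrite comul_coef !ffunE /=; case: eqP => [->|_];
  last first.
  by rewrite mul0r => /esym/eqP; rewrite mulf_eq0 (negPf ng) orbF => /eqP.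
by rewrite mul1r -{1}[u g]mulr1 => /(mulfI ng) <-.
Qed.

(** The products x y and y x are conjugate, so the sum over pairs whose product lies in the class is
    symmetric in the two factors. *)
Lemma class_sumM (g : G) (u v : galg k G) :
  \sum_(x in (g ^: [set: G])%g) (u * v) x = \sum_(x in (g ^: [set: G])%g) (v *
    u) x.
Proof.
suff S (w w' : galg k G) : \sum_(x in (g ^: [set: G])%g) (w * w') x =
    \sum_x \sum_y (if (x * y)%g \in (g ^: [set: G])%g then w x * w' y else 0).
  rewrite !S exchange_big; apply: eq_bigr => x _; apply: eq_bigr => y _.
  rewrite mulrC; have -> : (x * y = (y * x) ^ y)%g by rewrite conjgE mulgA
    mulKg.
  by rewrite memJ_norm // (subsetP (class_norm _ _)) ?inE.
rewrite big_mkcond; under eq_bigr => x _ do rewrite ffunE.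
transitivity (\sum_x \sum_z (if x \in (g ^: [set: G])%g then w z * w' (z^-1 *
  x)%g else 0)).
  by apply: eq_bigr => x _; case: ifP => // _; rewrite big1.
rewrite exchange_big; apply: eq_bigr => z _; rewrite (reindex_inj (mulgI z)) /=.
by apply: eq_bigr => y _; rewrite mulKg.
Qed.

(* The sum of the coefficients over a conjugacy class is a trace on k[G]. *)
Lemma gelt_conj_class (a : galg k G) g h : a \is a GRing.unit ->
  a * gelt k g = gelt k h * a -> h \in (g ^: [set: G])%g.
Proof.
move=> Ua e; have := class_sumM g (a * gelt k g) a^-1.
rewrite mulKr // e mulrK //.
have geltS z : \sum_(x in (g ^: [set: G])%g) gelt k z x = (z \in (g ^: [set:
  G])%g)%:R.
  have [zg|nz] := boolP (z \in _).
    rewrite (bigD1 z) //= ffunE eqxx big1 ?addr0 // => x /andP[_ /negPf ne].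
    by rewrite ffunE ne.
  rewrite big1 // => x xg; rewrite ffunE; case: eqP => // xz.
  by rewrite -xz xg in nz.
rewrite !geltS class_refl; case: (_ \in _) => // /eqP.
by rewrite eq_sym oner_eq0.
Qed.

Lemma symmetric_twist_coboundary : Defs.invariant F ->
  (forall phi : G -> G, {morph phi : g h / (g * h)%g} ->
     (forall g, phi g \in (g ^: [set: G])%g) ->
       exists x, forall g, phi g = (g ^ x)%g) ->
  exists2 a, lazyA1 a & F = delta1 a.
Proof.
move=> iF inner; have [a Ua eF] := symmetric_twist_trivialization.
have UF : F \is a GRing.unit by case: tF.
have Uaa : a ⊗ a \is a GRing.unit by apply: gtens_unit.
have geltU (g : G) : gelt k g \is a GRing.unit.
  apply/unitrP; exists (gelt k g^-1%g).
  by rewrite -!geltM mulgV mulVg.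
(* Conjugation by [a] permutes group elements: for u = a g a^-1, invariance gives Delta(u) (a (x) a)
   = Delta(u) F Delta(a) = F Delta(a g) = (a (x) a) Delta(g), so u is group-like. *)
have /fin_all_exists[phi phiE] (g : G) : exists h, a * gelt k g = gelt k h * a.
  pose u := a * gelt k g * a^-1.
  have [||h uh] := @grouplike_gelt u.
  - by apply: contraTneq (geltU g) => u0; rewrite -(mulKr Ua (gelt k g))
    -(mulrVK Ua (a * _)) -/u u0 mul0r mulr0 unitr0.
  - apply: (mulIr Uaa); rewrite gtensM mulrVK // -gtensM gtens_gelt -comul_gelt.
    by rewrite -{1}eF mulrA iF -mulrA -comulM mulrVK // comulM mulrA eF.
  by exists h; rewrite -uh mulrVK.
have phiM : {morph phi : g h / (g * h)%g}.
  move=> g h; have gelt_inj : injective (@gelt k G).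
    move=> x y /ffunP/(_ x); rewrite !ffunE eqxx; case: eqP => // _ /eqP.
    by rewrite oner_eq0.
  apply: gelt_inj; apply: (mulIr Ua); rewrite -phiE !geltM mulrA phiE.
  by rewrite -!mulrA phiE.
have [x phix] := inner phi phiM (fun g => gelt_conj_class Ua (phiE g)).
(* Since a g = (x^-1 g x) a, the product x a commutes with every g. Invariance of [F] lets Delta(x)
   pass, so the trivialization survives. *)
pose b := gelt k x * a; have Ub : b \is a GRing.unit by rewrite unitrMl.
have eb : F * comul b = b ⊗ b.
  rewrite /b comulM mulrA -iF -mulrA eF comul_gelt.
  by rewrite -gtens_gelt gtensM.
exists b.
  split=> //; apply/gcenterP => c; rewrite (gelt_sum c) mulr_suml mulr_sumr.
  apply: eq_bigr => g _; rewrite -scalerAl -scalerAr; congr (_ *: _).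
  by rewrite -mulrA phiE phix mulrA -!geltM conjgE mulgA mulgA mulgV mul1g
    geltM -mulrA.
have [Uc cV] := morph_unit (comul1 _ _) (@comulM _ _) Ub.
have -> : delta1 b = F * comul b * (comul b)^-1 by rewrite eb -cV.
by rewrite mulrK.
Qed.

End SymmetricTwist.

(** * Twists from bicharacters *)

Section Fourier.
Variable k : fieldType.

Definition bicharacter (W : finGroupType) (e : W -> W -> k) :=
  (forall x y z, e (x * y)%g z = e x z * e y z) /\
  (forall x y z, e x (y * z)%g = e x y * e x z) /\ (forall x y, e x y != 0).

(** Such a pairing identifies [W] with its character group, so Fourier transforms can be functions
    on [W] itself. *)
Definition perfect (W : finGroupType) (e : W -> W -> k) :=
  [/\ bicharacter e, forall x, (forall y, e x y = 1) -> x = 1%g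
    & forall y, (forall x, e x y = 1) -> y = 1%g].

Section Bicharacter.
Variables (W : finGroupType) (e : W -> W -> k).
Hypothesis be : bicharacter e.

Lemma bichar1l x : e 1%g x = 1.
Proof.
by case: be => eMl [_ nz]; apply: (mulfI (nz 1%g x));
  rewrite -eMl mul1g mulr1.
Qed.

Lemma bichar1r x : e x 1%g = 1.
Proof.
by case: be => _ [eMr nz]; apply: (mulfI (nz x 1%g));
  rewrite -eMr mul1g mulr1.
Qed.

Lemma bicharV x y : e x^-1%g y = e x y^-1%g.
Proof.
case: be => eMl [eMr nz]; apply: (mulfI (nz x y)).
by rewrite -eMl -eMr !mulgV bichar1l bichar1r.
Qed.
End Bicharacter.

Lemma bicharacter_sum (W : finGroupType) (e : W -> k) :
  {morph e : x y / (x * y)%g >-> x * y} -> (exists x, e x != 1) ->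
    \sum_x e x = 0.
Proof.
move=> eM [x0 ne]; apply/eqP; have: (1 - e x0) * \sum_x e x == 0.
  rewrite mulrBl mul1r {1}(reindex_inj (mulgI x0)) mulr_sumr subr_eq0.
  by apply/eqP/eq_bigr => x _; rewrite eM.
by rewrite mulf_eq0 subr_eq0 eq_sym (negPf ne).
Qed.

Section Transform.
Variables (W : finGroupType) (e : W -> W -> k).

Definition fourier (u : galg k W) x := \sum_w u w * e x w.
Definition fourier_inv (b : W -> k) : galg k W :=
  [ffun w => #|W|%:R^-1 * \sum_x b x * e x w^-1%g].

Hypothesis pe : perfect e.
Hypothesis nW : #|W|%:R != 0 :> k.
Let be : bicharacter e. Proof. by case: pe. Qed.

Lemma sum_pairing_l y : \sum_x e x y = #|W|%:R * (y == 1%g)%:R.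
Proof.
have [->|ny] := eqVneq y 1%g.
  by under eq_bigr => i _ do rewrite bichar1r //; rewrite sumr_const mulr1.
rewrite mulr0; apply: bicharacter_sum => [u v|]; first by case: be => ->.
apply/existsP; apply: contraR ny => /existsPn e1; have [_ _ r1] := pe;
  apply/eqP/r1 => x.
by apply/eqP/negbNE/e1.
Qed.

Lemma sum_pairing_r x : \sum_y e x y = #|W|%:R * (x == 1%g)%:R.
Proof.
have [->|nx] := eqVneq x 1%g.
  by under eq_bigr => i _ do rewrite bichar1l //; rewrite sumr_const mulr1.
rewrite mulr0; apply: bicharacter_sum => [u v|]; first by case: be => _ [->].
apply/existsP; apply: contraR nx => /existsPn e1; have [_ l1 _] := pe;
  apply/eqP/l1 => y.
by apply/eqP/negbNE/e1.
Qed.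

Lemma fourierK u : fourier_inv (fourier u) = u.
Proof.
case: be => eMl [eMr _]; apply/ffunP=> w; rewrite ffunE.
under eq_bigr => x _ do rewrite mulr_suml.
rewrite exchange_big /= (bigD1 w) //= [X in _ + X]big1 ?addr0 => [|y ne].
  under eq_bigr => x _ do rewrite -mulrA -eMr mulgV.
  by rewrite -mulr_sumr sum_pairing_l eqxx mulr1 mulrCA mulVf ?mulr1.
under eq_bigr => x _ do rewrite -mulrA -eMr.
by rewrite -mulr_sumr sum_pairing_l -eq_mulgV1 (negPf ne) !mulr0.
Qed.

Lemma fourier_invK b : fourier (fourier_inv b) =1 b.
Proof.
case: be => eMl [eMr _] x; rewrite /fourier.
under eq_bigr => w _ do rewrite ffunE -mulrA mulr_suml.
rewrite -mulr_sumr exchange_big /= (bigD1 x) //= [X in _ + X]big1 ?addr0 => [|y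
  ne].
  under eq_bigr => w _ do rewrite -mulrA -bicharV // -eMl mulVg.
  by rewrite -mulr_sumr sum_pairing_r eqxx mulr1 mulrCA mulVf ?mulr1.
under eq_bigr => w _ do rewrite -mulrA -bicharV // -eMl.
by rewrite -mulr_sumr sum_pairing_r -eq_mulVg1 (negPf ne) !mulr0.
Qed.

Lemma fourier_inj u v : fourier u =1 fourier v -> u = v.
Proof.
move=> e_uv; rewrite -[u]fourierK -[v]fourierK; apply/ffunP=> w.
by rewrite !ffunE; congr (_ * _); apply: eq_bigr => x _; rewrite e_uv.
Qed.

Lemma fourierM u v x : fourier (u * v) x = fourier u x * fourier v x.
Proof.
case: be => _ [eMr _]; rewrite /fourier mulr_suml.
under eq_bigr => w _ do rewrite ffunE mulr_suml.
rewrite exchange_big; apply: eq_bigr => y _ /=.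
rewrite mulr_sumr (reindex_inj (mulgI y)) /=; apply: eq_bigr => w _.
by rewrite mulKg eMr mulrACA.
Qed.

Lemma fourier1 x : fourier 1 x = 1.
Proof.
rewrite /fourier (bigD1 1%g) //= ffunE eqxx bichar1r // mulr1.
by rewrite big1 ?addr0 // => w /negPf ne; rewrite ffunE ne mul0r.
Qed.

End Transform.

(** The transform turns pushforward along [phi] into substitution of the adjoint [psi]. A coproduct,
    for instance, becomes multiplication of two variables. *)
Lemma fourier_push (W W' : finGroupType) e e' (phi : W -> W') (psi : W' ->
  W) u x :
  (forall w, e' x (phi w) = e (psi x) w) -> fourier e' (gpush phi u) x =
    fourier e u (psi x).
Proof.
move=> adj; rewrite /fourier (partition_big phi xpredT) //=.
apply: eq_bigr => y _; rewrite gpushE mulr_suml.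
by apply: eq_bigr => w /eqP <-; rewrite adj.
Qed.

Definition pairing_prod (W W' : finGroupType) (e : W -> W -> k) (e' : W' ->
  W' -> k)
  (x y : W * W') := e x.1 y.1 * e' x.2 y.2.

Lemma perfect_prod (W W' : finGroupType) (e : W -> W -> k) (e' : W' -> W' ->
  k) :
  perfect e -> perfect e' -> perfect (pairing_prod e e').
Proof.
move=> [b l r] [b' l' r']; have [eMl [eMr nz]] := b;
  have [eMl' [eMr' nz']] := b'.
split; first split=> [x y z|]; first by rewrite /pairing_prod eMl eMl' mulrACA.
- split=> [x y z|x y]; first by rewrite /pairing_prod eMr eMr' mulrACA.
  by rewrite mulf_neq0.
- move=> [x x'] e1; congr (_, _).
    by apply: l => y; have := e1 (y, 1%g);
      rewrite /pairing_prod /= bichar1r // mulr1.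
  by apply: l' => y; have := e1 (1%g, y); rewrite /pairing_prod /= bichar1r //
    mul1r.
- move=> [x x'] e1; congr (_, _).
    by apply: r => y; have := e1 (y, 1%g);
      rewrite /pairing_prod /= bichar1l // mulr1.
  by apply: r' => y; have := e1 (1%g, y); rewrite /pairing_prod /= bichar1l //
    mul1r.
Qed.

(** * Bicharacters as Fourier transforms of twists *)

Section BicharacterTwist.
Variables (W : finGroupType) (e : W -> W -> k).
Hypotheses (pe : perfect e) (nW : #|W|%:R != 0 :> k).
Let e2 := pairing_prod e e.
Let e3 := pairing_prod e2 e.
Let be : bicharacter e. Proof. by case: pe. Qed.
Let pe2 : perfect e2. Proof. exact: perfect_prod. Qed.
Let pe3 : perfect e3. Proof. exact: perfect_prod. Qed.
Let nW2 : #|{: W * W}|%:R != 0 :> k.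
Proof. by rewrite card_prod natrM mulf_neq0. Qed.
Let nW3 : #|{: W * W * W}|%:R != 0 :> k.
Proof. by rewrite !card_prod !natrM !mulf_neq0. Qed.

Definition bichar_twist (b : W -> W -> k) : galg k (W * W)%type :=
  fourier_inv e2 (fun x => b x.1 x.2).

Lemma fourier_bichar_twist b x : fourier e2 (bichar_twist b) x = b x.1 x.2.
Proof. exact: (fourier_invK pe2 nW2). Qed.

Lemma bichar_twist_uniq u b : (forall x, fourier e2 u x = b x.1 x.2) ->
  u = bichar_twist b.
Proof.
by move=> ub; apply: (fourier_inj pe2 nW2) => x;
  rewrite ub fourier_bichar_twist.
Qed.

Lemma bichar_twist_inj b b' : bichar_twist b = bichar_twist b' -> b =2 b'.
Proof.
move=> ebb x y.
by rewrite -[LHS](fourier_bichar_twist b (x, y)) ebb fourier_bichar_twist.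
Qed.

Lemma eq_bichar_twist b b' : b =2 b' -> bichar_twist b = bichar_twist b'.
Proof.
by move=> ebb; apply: bichar_twist_uniq => x;
  rewrite fourier_bichar_twist ebb.
Qed.

Lemma bichar_twistM b b' :
  bichar_twist b * bichar_twist b' = bichar_twist (fun x y => b x y * b' x y).
Proof.
apply: bichar_twist_uniq => x; rewrite (fourierM pe2) !fourier_bichar_twist //.
Qed.

Lemma bichar_twist1 : bichar_twist (fun _ _ => 1) = 1.
Proof. by apply/esym/bichar_twist_uniq => x; rewrite (fourier1 pe2). Qed.

Lemma gswap_bichar_twist b : gswap (bichar_twist b) = bichar_twist (fun x y =>
  b y x).
Proof.
apply: bichar_twist_uniq => x; rewrite (@fourier_push _ _ e2 _ _ (fun x =>
  (x.2, x.1))).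
  by rewrite fourier_bichar_twist.
by move=> w; rewrite /e2 /pairing_prod mulrC.
Qed.

Lemma bichar_twist_push b (s t : W -> W) :
  (forall x w, e x (s w) = e (t x) w) ->
  (forall x y, b (t x) (t y) = b x y) ->
  gpush (fun x => (s x.1, s x.2)) (bichar_twist b) = bichar_twist b.
Proof.
move=> adj bt; apply: bichar_twist_uniq => x.
rewrite (@fourier_push _ _ e2 _ _ (fun x => (t x.1, t x.2))).
  by rewrite fourier_bichar_twist /= bt.
by move=> w; rewrite /e2 /pairing_prod !adj.
Qed.

Lemma bichar_twist_unit b : bicharacter b -> bichar_twist b \is a GRing.unit.
Proof.
move=> [_ [_ nz]]; apply/unitrP; exists (bichar_twist (fun x y => (b x y)^-1)).
by rewrite !bichar_twistM -bichar_twist1; split; apply: eq_bichar_twist => x y;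
   rewrite ?mulVf ?mulfV.
Qed.

(** Under the transform the cocycle identity reads b(x, y) b(x y, z) = b(y, z) b(x, y z); both sides
    equal b(x, y) b(x, z) b(y, z). *)
Lemma bichar_twist_twist b : bicharacter b -> twist (bichar_twist b).
Proof.
move=> bb; split; first exact: bichar_twist_unit.
have [bMl [bMr _]] := bb; have [eMl _] := be.
apply: (fourier_inj pe3 nW3) => x; rewrite !(fourierM pe3).
rewrite tens1r_push (@fourier_push _ _ e2 _ _ (fun x => x.1)); last first.
  by move=> w; rewrite /e3 /e2 /pairing_prod /= bichar1r // mulr1.
rewrite comul_id_push.
rewrite (@fourier_push _ _ e2 _ _ (fun x => (x.1.1 * x.1.2, x.2)%g)); last first.
  by move=> w; rewrite /e3 /e2 /pairing_prod /= eMl.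
rewrite tens1l_push (@fourier_push _ _ e2 _ _ (fun x => (x.1.2, x.2)));
  last first.
  by move=> w; rewrite /e3 /e2 /pairing_prod /= bichar1r // mul1r.
rewrite id_comul_push.
rewrite (@fourier_push _ _ e2 _ _ (fun x => (x.1.1, x.1.2 * x.2)%g)); last first.
  by move=> w; rewrite /e3 /e2 /pairing_prod /= eMl mulrA.
by rewrite !fourier_bichar_twist /= bMl bMr mulrA mulrC.
Qed.

(** The transform at (x, z) is the sum over v of e(x, v) times the transform of row v at z. The rows
    being orthogonal idempotents, cross terms vanish in the product. *)
Lemma fourier_left_character (r : galg k (W * W)%type) : left_character (fun v
  w => r (v, w)) ->
  forall x y z,
    fourier e2 r ((x * y)%g, z) = fourier e2 r (x, z) * fourier e2 r (y, z).
Proof.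
move=> rl; have [eMl [eMr _]] := be.
have fE x z : fourier e2 r (x, z) =
    \sum_v e x v * fourier e (row_elt (fun v w => r (v, w)) v) z.
  transitivity (\sum_v \sum_w r (v, w) * (e x v * e z w)).
    by rewrite pair_bigA; apply: eq_bigr => -[].
  apply: eq_bigr => v _; rewrite mulr_sumr; apply: eq_bigr => w _.
  by rewrite ffunE mulrCA.
move=> x y z; rewrite !fE mulr_suml; apply: eq_bigr => v _.
rewrite [RHS]mulr_sumr [RHS](bigD1 v) //= [X in _ + X]big1 ?addr0 => [|v' ne].
  by rewrite mulrACA -(fourierM pe) left_character_rowM // eqxx scale1r eMl.
rewrite mulrACA -(fourierM pe) left_character_rowM // eq_sym (negPf ne) scale0r.
by rewrite /fourier big1 ?mulr0 // => w _; rewrite gzeroE mul0r.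
Qed.

Lemma fourier_character (r : galg k (W * W)%type) : left_character (fun v w =>
  r (v, w)) ->
  right_character (fun v w => r (v, w)) -> r \is a GRing.unit ->
  bicharacter (fun x y => fourier e2 r (x, y)).
Proof.
move=> rl rr Ur; split; first exact: fourier_left_character.
have fswap x y : fourier e2 r (x, y) = fourier e2 (gswap r) (y, x).
  rewrite (@fourier_push _ _ e2 _ _ (fun x => (x.2, x.1))) //.
  by move=> w; rewrite /e2 /pairing_prod mulrC.
split=> [x y z|x y].
  rewrite !fswap fourier_left_character // => v v' w; rewrite !gswapE.
  rewrite (right_left_character rr); apply: eq_bigr => u _; by rewrite !gswapE.
apply: contraTneq isT => f0; have := fourier1 pe2 (x, y).
by rewrite -(mulVr Ur) (fourierM pe2) f0 mulr0 => /esym/eqP; rewrite oner_eq0.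
Qed.

End BicharacterTwist.

End Fourier.

(** * The wreath product *)

Section WreathStructure.
Variables (K : finFieldType) (C : finGroupType).
Local Notation V := (galg K C).
Local Notation G := (wreath K C).
Implicit Types (v w : V) (c d : C) (g h : G).

Definition base_elt v : G := sdpair1 (translate_groupAction K C) v.
Definition top_elt c : G := sdpair2 (translate_groupAction K C) c.

Lemma base_eltM : {morph base_elt : v w / (v * w)%g}.
Proof. by move=> v w; apply: sdpair1_morphM; rewrite inE. Qed.

(** The group law of [V] is the addition of the algebra, so [base_eltM] applies up to conversion. *)
Lemma base_eltD : {morph base_elt : v w / v + w >-> (v * w)%g}.
Proof. exact: base_eltM. Qed.

Lemma base_elt0 : base_elt 0 = 1%g.
Proof. by apply: (@mulgI G (base_elt 0)); rewrite -base_eltD addr0 mulg1. Qed.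

Lemma base_elt_inj : injective base_elt.
Proof.
have /injmP I := injm_sdpair1 (translate_groupAction K C).
by move=> v w; apply: I; rewrite inE.
Qed.

Lemma top_eltM : {morph top_elt : c d / (c * d)%g}.
Proof. by move=> c d; apply: sdpair2_morphM; rewrite inE. Qed.

Lemma top_elt1 : top_elt 1 = 1%g.
Proof. by apply: (@mulgI G (top_elt 1)); rewrite -top_eltM !mulg1. Qed.

Lemma wreathE g : exists c v, g = (top_elt c * base_elt v)%g.
Proof.
by exists g.1, g.2; apply: (@sdpairE _ _ _ _ (translate_groupAction K
  C)).
Qed.

Lemma base_conj_top v c : (base_elt v ^ top_elt c)%g = base_elt (gelt K c^-1 *
  v).
Proof. by rewrite /base_elt /top_elt -sdpair_act ?inE. Qed.

Lemma base_conj_base v w : (base_elt v ^ base_elt w)%g = base_elt v.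
Proof. by rewrite conjgE -base_eltD addrC base_eltD mulKg. Qed.

Lemma base_conj v w c :
  (base_elt w ^ (top_elt c * base_elt v))%g = base_elt (gelt K c^-1 * w).
Proof. by rewrite conjgM base_conj_top base_conj_base. Qed.

Lemma base_eltN v : base_elt (- v) = (base_elt v)^-1%g.
Proof.
by apply: (@mulgI G (base_elt v)); rewrite -base_eltD subrr base_elt0
  mulgV.
Qed.

(* Commuting with the commutator of h with 1 in V forces (1 - c^-1)^2 = 0 in
   K[C], whose coefficient at 1 is 1 or 2 when c != 1. *)
Lemma base_commute_conj c v : 2 != 0 :> K ->
  (forall w, commute (top_elt c * base_elt v) ((top_elt c * base_elt v) ^
    base_elt w))%g ->
  c = 1%g.
Proof.
move=> two cw; pose h := (top_elt c * base_elt v)%g;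
  pose t : V := 1 - gelt K c^-1.
have ht : commute h (base_elt t).
  have -> : base_elt t = [~ h, base_elt 1%R]%g.
    by rewrite commgEr -base_eltN base_conj -base_eltD /t mulrN mulr1 addrC.
  by rewrite commgEl; apply/commuteM => //; apply/commuteV.
have /ffunP/(_ 1%g) : gelt K c^-1 * t = t.
  by apply: base_elt_inj; rewrite -(base_conj v) -/h;
    apply/conjg_fixP/commgP/commute_sym.
rewrite gelt_mulE invgK mulg1 !gaddE => e; apply/eqP; apply: contraR two => nc;
  move: e.
have gN u x : (- u : V) x = - u x by rewrite -scaleN1r gscaleE mulN1r.
rewrite !gN !ffunE eqxx (negPf nc) add0r (_ : (1 == c^-1)%g = false);
  last first.
  by rewrite -(inj_eq (mulgI c)) mulg1 mulgV (negPf nc).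
move=> /eqP; rewrite subr0 eq_sym -subr_eq0 opprK.
by case: (c == _) => //=; rewrite mulr0n addr0 oner_eq0.
Qed.

(** The support of [r] is stable under simultaneous conjugation, so [h] commutes with its conjugates
    by base elements, which excludes a nontrivial top component. *)
Lemma character_support (F : fieldType) (r : G -> G -> F) : 2 != 0 :> K ->
  left_character r -> right_character r ->
  (forall g h x, r (g ^ x)%g (h ^ x)%g = r g h) ->
  forall g h, r g h != 0 -> exists w, h = base_elt w.
Proof.
move=> two rl rr rJ g h nz; have [c [v hE]] := wreathE h.
suff c1 : c = 1%g by exists v; rewrite hE c1 top_elt1 mul1g.
apply: (base_commute_conj (v := v) two) => w; rewrite -hE.
by apply: (support_commute rl rr nz (g' := (g ^ base_elt w)%g)); rewrite rJ.
Qed.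

Definition base_elt2 (x : V * V) : G * G := (base_elt x.1, base_elt x.2).

Lemma base_elt2M : {morph base_elt2 : x y / (x * y)%g}.
Proof. by move=> x y; rewrite /base_elt2 !base_eltM. Qed.

Lemma base_elt2_inj : injective base_elt2.
Proof. by move=> [x y] [x' y'] [/base_elt_inj-> /base_elt_inj->]. Qed.

Lemma sum_base_elt (F : fieldType) (f : G -> F) :
  (forall g, f g != 0 -> exists v, g = base_elt v) ->
    \sum_g f g = \sum_v f (base_elt v).
Proof.
move=> f_supp; rewrite (bigID [in base_elt @: [set: V]]) /= [X in _ + X]big1
  ?addr0.
  rewrite big_imset /= => [|v w _ _]; last exact: base_elt_inj.
  by apply: eq_bigl => v; rewrite inE.
by move=> g; apply: contraNeq => /f_supp[v ->]; rewrite imset_f ?inE.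
Qed.

(** The support lemma, applied also to the transposed coefficients, confines both legs to the base.
    The sums over [G] in the character identities then reduce to sums over [V]. *)
Lemma rmatrix_descent (F : fieldType) (T : galg F (G * G)%type) : 2 != 0 :> K ->
  invtwist T -> exists r : galg F (V * V)%type,
    [/\ rmatrix T = gpush base_elt2 r,
      left_character (fun v w => r (v, w)) &
      right_character (fun v w => r (v, w))].
Proof.
move=> two iT; pose R g h := rmatrix T (g, h).
have rl : left_character R := rmatrix_left_character iT.
have rr : right_character R := rmatrix_right_character iT.
have rJ g h x : R (g ^ x)%g (h ^ x)%g = R g h := rmatrix_conj iT g h x.
have suppr g h : R g h != 0 -> exists w, h = base_elt w.
  exact: character_support.
have suppl g h : R g h != 0 -> exists v, g = base_elt v.
  apply: (@character_support _ (fun g h => R h g)) => //.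
    exact: right_left_character.
  exact: left_right_character.
exists [ffun x => R (base_elt x.1) (base_elt x.2)]; split.
- apply/ffunP=> -[g h]; have [R0|nz] := eqVneq (R g h) 0; last first.
    have [v gE] := suppl _ _ nz; have [w hE] := suppr _ _ nz.
    by rewrite gE hE [RHS](gpush_injE _ (v, w) base_elt2_inj) [RHS]ffunE.
  rewrite [LHS]R0 gpushE big1 // => -[v w] /eqP[gE hE].
  by rewrite ffunE /= gE hE.
- move=> v v' w; rewrite !ffunE /=.
  have := rl (base_elt v) (base_elt v') (base_elt w).
  rewrite (inj_eq base_elt_inj) => ->; rewrite sum_base_elt => [|z].
    by apply: eq_bigr => z _; rewrite !ffunE /= base_eltM -base_eltN.
  by rewrite mulf_eq0 negb_or => /andP[/suppr].
- move=> v w w'; rewrite !ffunE /=.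
  have := rr (base_elt v) (base_elt w) (base_elt w').
  rewrite (inj_eq base_elt_inj) => ->; rewrite sum_base_elt => [|z].
    by apply: eq_bigr => z _; rewrite !ffunE /= base_eltM -base_eltN.
  by rewrite mulf_eq0 negb_or => /andP[/suppl].
Qed.

End WreathStructure.

(** * Class-preserving endomorphisms of the wreath product *)

Section ClassPreserving.
Variable p : nat.
Hypothesis p_prime : prime p.
Local Notation V := (galg 'F_p 'Z_p).
Local Notation G := (wreath 'F_p 'Z_p).

Lemma Zp_commute (c d : 'Z_p) : commute c d.
Proof. exact: addrC. Qed.

(** The scalars form a prime field, so the group elements generate [V] already as an additive
    group. *)
Lemma base_gen_ind (P : V -> Prop) : P 0 -> (forall v w, P v -> P w ->
  P (v + w)) ->
  (forall c, P (gelt 'F_p c)) -> forall v, P v.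
Proof.
move=> P0 PD Pg v; rewrite (gelt_sum v); apply: big_ind => // c _.
rewrite -[v c]natr_Zp scaler_nat; elim: (v c : nat) => [|n IHn];
  first by rewrite mulr0n.
by rewrite mulrS; apply: PD.
Qed.

(* Once phi fixes the top group pointwise, its restriction to the base commutes
   with the action of C, so it is determined by the image of 1, which is a
   translate of 1. *)
Lemma class_preserving_inner (phi : G -> G) : {morph phi : g h / (g * h)%g} ->
  (forall g, phi g \in (g ^: [set: G])%g) ->
    exists x, forall g, phi g = (g ^ x)%g.
Proof.
move=> phiM phi_class; pose c0 : 'Z_p := Zp1.
have /imsetP[y _ phi_c0] := phi_class (top_elt 'F_p c0).
(* On the generator [c0] of the top group [phi] is conjugation by [y]; undoing it makes [psi] fix
   the top group pointwise. *)
pose psi g := (phi g ^ y^-1)%g.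
have psiM : {morph psi : g h / (g * h)%g} by move=> g h;
  rewrite /psi phiM conjMg.
have psi1 : psi 1%g = 1%g by apply: (@mulgI _ (psi 1%g)); rewrite -psiM !mulg1.
have psi_top c : psi (top_elt 'F_p c) = top_elt 'F_p c.
  have -> : c = (c0 ^+ c)%g by rewrite Zp1_expgz.
  elim: (c : nat) => [|n IHn]; first by rewrite expg0 top_elt1.
  by rewrite expgS top_eltM psiM IHn /psi phi_c0 conjgK.
have [d psi_one] : exists d, psi (base_elt 1) = base_elt (gelt 'F_p d).
  have /imsetP[z _ ez] := phi_class (base_elt 1).
  have [c [v e]] := wreathE (z * y^-1)%g.
  by exists c^-1%g; rewrite /psi ez -conjgM e base_conj mulr1.
have psi_base v : psi (base_elt v) = (base_elt v ^ top_elt 'F_p d^-1)%g.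
  elim/base_gen_ind: v => [|v w IHv IHw|c].
  - by rewrite base_elt0 psi1 conj1g.
  - by rewrite base_eltD psiM IHv IHw conjMg.
  have -> : base_elt (gelt 'F_p c) = (base_elt 1%R ^ top_elt 'F_p c^-1)%g.
    by rewrite base_conj_top invgK mulr1.
  have psiJ g h : psi (g ^ h)%g = (psi g ^ psi h)%g.
    by apply: (@mulgI _ (psi h)); rewrite -[RHS]conjgC -!psiM -conjgC.
  rewrite psiJ psi_top psi_one !base_conj_top !invgK mulr1 -!geltM.
  (* The two sides are the translates of 1 by c d and by d c; commutativity of the top group
     identifies them. *)
  by congr (base_elt (gelt _ _)); apply: Zp_commute.
exists (top_elt 'F_p d^-1 * y)%g => g; rewrite conjgM;
  apply: (canRL (conjgKV y)).
have [c [v ->]] := wreathE g; rewrite -/(psi _) psiM psi_top psi_base conjMg.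
congr (_ * _)%g; apply/esym/conjg_fixP/commgP.
by rewrite /commute -!top_eltM Zp_commute.
Qed.


End ClassPreserving.

(** * Invariant alternating bicharacters on the base *)

(** A root of 1 + X + ... + X^(p-1) is a p-th root of unity, and it differs from 1 because the
    polynomial takes the nonzero value p there. *)
Lemma prime_prim_root (k : closedFieldType) (p : nat) :
  prime p -> p%:R != 0 :> k -> exists z : k, p.-primitive_root z.
Proof.
move=> p_pr np; pose q : {poly k} := \poly_(i < p) 1.
have szq : size q = p by apply: size_poly_eq; rewrite oner_eq0.
have /closed_rootP[z /rootP qz] : size q != 1 by rewrite szq;
  case: (p) p_pr => [|[]].
have qE x : q.[x] = \sum_(i < p) x ^+ i.
  by rewrite horner_poly; apply: eq_bigr => i _; rewrite mul1r.
have zp : z ^+ p = 1.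
  by apply/eqP; rewrite -subr_eq0 subrX1 -qE qz mulr0.
have [m zm mp] := prim_order_exists (prime_gt0 p_pr) zp.
suff m1 : m != 1 by exists z; move/(prime_nt_dvdP p_pr m1): mp zm => ->.
apply: contraNneq np => m1; move: qz; rewrite qE.
have -> : z = 1 by have := prim_expr_order zm; rewrite m1 expr1.
by under eq_bigr do rewrite expr1n; rewrite sumr_const card_ord => ->.
Qed.

Section RootOfUnity.
Variables (k : fieldType) (p : nat) (z : k).
Hypotheses (p_prime : prime p) (z_prim : p.-primitive_root z).

Definition zeta_exp (x : 'F_p) : k := z ^+ x.

Lemma zeta_expD : {morph zeta_exp : x y / x + y >-> x * y}.
Proof.
move=> x y; rewrite /zeta_exp -exprD.
have -> : (x + y : 'F_p) = (((x : nat) + y)%N %% p)%N :> nat.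
  by rewrite -[X in (_ %% X)%N](Fp_cast p_prime).
exact: prim_expr_mod.
Qed.

Lemma zeta_exp0 : zeta_exp 0 = 1. Proof. exact: expr0. Qed.

Lemma zeta_exp_neq0 x : zeta_exp x != 0.
Proof. by rewrite expf_neq0 // (prim_root_eq0 z_prim) -lt0n prime_gt0. Qed.

Lemma zeta_exp_inj : injective zeta_exp.
Proof.
move=> x y /eqP; rewrite (eq_prim_root_expr z_prim) => /eqP e; apply: val_inj.
by rewrite /= -[LHS](@modn_small _ p) ?e ?modn_small // -{2}(Fp_cast p_prime).
Qed.

Lemma zeta_exp_surj x : x ^+ p = 1 -> exists i, x = zeta_exp i.
Proof.
move=> xp; have [i ->] := prim_rootP z_prim xp; exists (inZp i).
by rewrite /zeta_exp /= Fp_cast // modn_small.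
Qed.

End RootOfUnity.

(** * Circulant forms on the base and odd functions on Z/p *)

Section Forms.
Variable p : nat.
Hypothesis p_prime : prime p.
Local Notation V := (galg 'F_p 'Z_p).
Implicit Types (x y v w : V) (c d : 'Z_p) (nu : 'Z_p -> 'F_p).

Definition dot x v : 'F_p := \sum_c x c * v c.

Lemma dotDl x y v : dot (x + y) v = dot x v + dot y v.
Proof.
by rewrite /dot -big_split; apply: eq_bigr => c _;
  rewrite gaddE mulrDl.
Qed.

Lemma dotC x v : dot x v = dot v x.
Proof. by apply: eq_bigr => c _; rewrite mulrC. Qed.

Lemma dotDr x v w : dot x (v + w) = dot x v + dot x w.
Proof. by rewrite !(dotC x) dotDl. Qed.

Lemma dot_gelt x c : dot x (gelt 'F_p c) = x c.
Proof.
rewrite /dot (bigD1 c) //= ffunE eqxx mulr1 big1 ?addr0 // => d /negPf ne.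
by rewrite ffunE ne mulr0.
Qed.

Lemma dot_translate x v c : dot x (gelt 'F_p c^-1 * v) = dot (gelt 'F_p c * x)
  v.
Proof.
rewrite /dot (reindex_inj (mulgI c^-1%g)) /=; apply: eq_bigr => d _.
by rewrite !gelt_mulE mulKg.
Qed.

(** The bilinear form whose matrix in the basis of group elements is circulant; these are the
    translation-invariant forms. *)
Definition circ_form nu x y : 'F_p := \sum_c \sum_d x c * y d * nu (c^-1 * d)%g.

Lemma circ_formDl nu x y v : circ_form nu (x + y) v = circ_form nu x v +
  circ_form nu y v.
Proof.
rewrite /circ_form -big_split; apply: eq_bigr => c _; rewrite -big_split.
by apply: eq_bigr => d _; rewrite gaddE !mulrDl.
Qed.

Lemma circ_formDr nu x v w : circ_form nu x (v + w) = circ_form nu x v +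
  circ_form nu x w.
Proof.
rewrite /circ_form -big_split; apply: eq_bigr => c _; rewrite -big_split.
by apply: eq_bigr => d _; rewrite gaddE mulrDr mulrDl.
Qed.

Lemma circ_form_gelt nu c d : circ_form nu (gelt 'F_p c) (gelt 'F_p d) = nu
  (c^-1 * d)%g.
Proof.
rewrite /circ_form (bigD1 c) //= [X in _ + X]big1 ?addr0 => [|c' /negPf ne];
  last first.
  by apply: big1 => d' _; rewrite ffunE ne !mul0r.
rewrite (bigD1 d) //= [X in _ + X]big1 ?addr0 => [|d' /negPf ne].
  by rewrite !ffunE !eqxx !mul1r.
by rewrite [gelt _ d d']ffunE ne mulr0 mul0r.
Qed.

Lemma circ_form_translate nu x y c :
  circ_form nu (gelt 'F_p c * x) (gelt 'F_p c * y) = circ_form nu x y.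
Proof.
rewrite /circ_form (reindex_inj (mulgI c)) /=; apply: eq_bigr => a _.
rewrite (reindex_inj (mulgI c)) /=; apply: eq_bigr => b _.
by rewrite !gelt_mulE !mulKg invMg -mulgA mulKg.
Qed.

Lemma circ_form_swap nu x y : (forall c, nu c^-1%g = - nu c) ->
  circ_form nu y x = - circ_form nu x y.
Proof.
move=> nuV; rewrite /circ_form exchange_big -sumrN; apply: eq_bigr => c _.
rewrite -sumrN; apply: eq_bigr => d _.
by rewrite -mulrN -nuV invMg invgK (mulrC (y d)).
Qed.

Lemma circ_formD nu nu' x y : circ_form (fun c => nu c + nu' c) x y = circ_form
  nu x y + circ_form nu' x y.
Proof.
rewrite /circ_form -big_split; apply: eq_bigr => c _; rewrite -big_split.
by apply: eq_bigr => d _; rewrite mulrDr.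
Qed.

Lemma eq_circ_form nu nu' : nu =1 nu' -> circ_form nu =2 circ_form nu'.
Proof. by move=> e x y; do 2![apply: eq_bigr => ? _]; rewrite e. Qed.

Lemma additive_ext (f f' : V -> 'F_p) : {morph f : x y / x + y} ->
  {morph f' : x y / x + y} -> (forall c, f (gelt 'F_p c) = f' (gelt 'F_p c)) ->
    f =1 f'.
Proof.
move=> fD fD' e x.
have z0 (g : V -> 'F_p) : {morph g : x y / x + y} -> g 0 = 0.
  by move=> gD; apply: (addrI (g 0)); rewrite -gD !addr0.
elim/base_gen_ind: x => [|x y ex ey|//]; first by rewrite !z0.
by rewrite fD fD' ex ey.
Qed.

Lemma circ_form_uniq (f : V -> V -> 'F_p) nu :
  (forall x y v, f (x + y) v = f x v + f y v) ->
  (forall x v w, f x (v + w) = f x v + f x w) ->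
  (forall c d, f (gelt 'F_p c) (gelt 'F_p d) = nu (c^-1 * d)%g) ->
  f =2 circ_form nu.
Proof.
move=> fDl fDr fg x y.
apply: (@additive_ext (f^~ y) ((circ_form nu)^~ y)) => [? ?|? ?|c];
  rewrite ?fDl ?circ_formDl //.
apply: additive_ext => [? ?|? ?|d]; rewrite ?fDr ?circ_formDr //.
by rewrite fg circ_form_gelt.
Qed.

Definition half_order := ((p - 1) %/ 2)%N.
Implicit Types u : 'rV['F_p]_half_order.

(** Entry [j] is placed at [j.+1]. The value is 0 at 0, and a failing [insub] makes it 0 beyond
    [half_order]. *)
Definition odd_ext_half u (i : nat) : 'F_p :=
  if i is j.+1 then oapp (u 0) 0 (insub j) else 0.

(* The odd function taking the values u_0, u_1, ... at 1, 2, ..., (p-1)/2. *)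
Definition odd_ext u c : 'F_p := odd_ext_half u c - odd_ext_half u (- c).

Lemma odd_extV u c : odd_ext u c^-1%g = - odd_ext u c.
Proof. by rewrite /odd_ext opprB -[(c^-1)%g]/(- c) opprK. Qed.

Lemma odd_extD u u' c : odd_ext (u + u') c = odd_ext u c + odd_ext u' c.
Proof.
have hD i : odd_ext_half (u + u') i = odd_ext_half u i + odd_ext_half u' i.
  case: i => [|i] /=; first by rewrite addr0.
  by case: insub => [j|] /=; rewrite ?mxE ?addr0.
by rewrite /odd_ext !hD opprD addrACA.
Qed.

Hypothesis p_odd : odd p.

Lemma two_neq0 : 2 != 0 :> 'F_p.
Proof.
rewrite -(dvdn_pcharf (pchar_Fp p_prime)); apply: contraL p_odd => p2.
by move: p2; rewrite dvdn_prime2 // => /eqP->.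
Qed.

Lemma p_half : p = (half_order.*2).+1.
Proof.
by rewrite /half_order; lia.
Qed.

Lemma ltn_Zp c : (c < p)%N.
Proof. by rewrite -[X in (_ < X)%N](Zp_cast (prime_gt1 p_prime)). Qed.

Lemma valN_Zp c : c != 0 -> (- c : 'Z_p) = (p - c)%N :> nat.
Proof.
move=> nc; have c_gt0 : (0 < c)%N by rewrite lt0n; apply: contra nc => /eqP e;
  apply/eqP/val_inj.
have cp := ltn_Zp c; have pE := Zp_cast (prime_gt1 p_prime).
have -> : nat_of_ord (- c) = (((Zp_trunc p).+2 - c) %% (Zp_trunc p).+2)%N by [].
move: (nat_of_ord c) c_gt0 cp => i i_gt0 ip; rewrite pE modn_small //; lia.
Qed.

Lemma odd_ext_half_big u i : (half_order < i)%N -> odd_ext_half u i = 0.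
Proof. by case: i => //= i hi; rewrite insubN // -leqNgt. Qed.

Lemma odd_ext_surj nu : (forall c, nu c^-1%g = - nu c) ->
  exists u, odd_ext u =1 nu.
Proof.
move=> nuV; exists (\row_j nu (inZp j.+1)) => c; rewrite /odd_ext.
have halfE (d : 'Z_p) : (0 < d <= half_order)%N ->
    odd_ext_half (\row_j nu (inZp j.+1)) d = nu d.
  move=> /andP[d0 dh]; case dE: (d : nat) d0 => [|j] // _; rewrite /=.
  rewrite insubT /= -?dE // => lt_j; rewrite mxE /= -dE.
  by congr nu; apply: val_inj; rewrite /= modn_small.
have [->|nc] := eqVneq c 0.
  (* Oddness at 0 only gives 2 nu(0) = 0; invertibility of 2 finishes. *)
  have nu0 : nu 0 + nu 0 = 0 by rewrite -{2}[0]oppr0 [nu (- 0)]nuV subrr.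
  rewrite oppr0 subrr; apply/esym/eqP.
  have : 2%:R * nu 0 == 0 by rewrite mulr_natl mulr2n nu0.
  by rewrite mulf_eq0 (negPf two_neq0).
have cp := ltn_Zp c; have c_gt0 : (0 < c)%N by rewrite lt0n;
  apply: contra nc => /eqP e; apply/eqP/val_inj.
(* Exactly one of c and p - c lies between 1 and [half_order], so only one of the two terms of
   [odd_ext] contributes. *)
have := p_half => pE; have [ch|hc] := leqP c half_order.
  rewrite halfE ?c_gt0 // odd_ext_half_big ?subr0 // valN_Zp //; lia.
rewrite odd_ext_half_big // sub0r halfE ?[nu _]nuV ?opprK // valN_Zp //; lia.
Qed.

(** Since [odd_ext] is additive, a trivial kernel gives injectivity. At [c = j.+1] the negative p -
    c exceeds [half_order], so the value there is the entry of index [j]. *)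
Lemma odd_ext_inj u : (forall c, odd_ext u c = 0) -> u = 0.
Proof.
move=> u0; apply/rowP=> j; rewrite mxE.
have jp : (j.+1 < p)%N.
  rewrite [X in (_ < X)%N]p_half ltnS -addnn;
    apply: leq_trans (ltn_ord j) (leq_addr _ _).
pose c : 'Z_p := inZp j.+1.
have cE : c = j.+1 :> nat by rewrite /= Zp_cast ?prime_gt1 // modn_small.
have nc : c != 0 by apply/eqP => /(congr1 val) /=; rewrite -[LHS]/(c : nat) cE.
have := u0 c; rewrite /odd_ext valN_Zp // (odd_ext_half_big u (i := (p - c)%N)).
  rewrite cE subr0 /= => <-; rewrite insubT //= => lt_j.
  by congr (u _ _); apply: val_inj.
by have := p_half; have := ltn_ord j; rewrite cE; lia.
Qed.

End Forms.

(** * Twists on the wreath product *)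

Section PushTwist.
Variables (K : fieldType) (H G : finGroupType) (phi : H -> G).
Hypothesis phiM : {morph phi : g h / (g * h)%g}.
Let phi1 : phi 1%g = 1%g.
Proof. by apply: (@mulgI _ (phi 1%g)); rewrite -phiM !mulg1. Qed.
Let phi2 (x : H * H) : G * G := (phi x.1, phi x.2).
Let phi3 (x : H * H * H) : G * G * G := (phi2 x.1, phi x.2).
Let phi2M : {morph phi2 : g h / (g * h)%g}.
Proof. by move=> g h; rewrite /phi2 !phiM. Qed.
Let phi3M : {morph phi3 : g h / (g * h)%g}.
Proof. by move=> g h; rewrite /phi3 phi2M phiM. Qed.

Lemma gpush_twist (F : galg K (H * H)%type) : twist F -> twist (gpush phi2 F).
Proof.
move=> [UF tF]; split; first exact: gpush_unit.
have := congr1 (gpush phi3) tF; rewrite !(gpushM phi3M).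
rewrite !tens1r_push !tens1l_push !comul_id_push !id_comul_push !gpush_comp =>
  e.
rewrite -[LHS]/(_ * _).
rewrite (@eq_gpush _ _ _ _ (phi3 \o (fun x => (x.1, x.2, 1%g)))); last first.
  by move=> x; rewrite /= /phi3 /= phi1.
rewrite e; congr (_ * _); apply: eq_gpush => x.
by rewrite /= /phi3 /phi2 /= phi1.
Qed.
End PushTwist.

Lemma invariant_gelt (K : fieldType) (G : finGroupType) (F : galg K (G *
  G)%type) :
  (forall g, comul (gelt K g) * F = F * comul (gelt K g)) -> Defs.invariant F.
Proof.
move=> iF a; rewrite (gelt_sum a) linear_sum mulr_suml mulr_sumr.
by apply: eq_bigr => g _; rewrite linearZ /= -scalerAl -scalerAr iF.
Qed.

(** Because g x^g = x g, commuting with g amounts to being fixed by pushforward along conjugation by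
    g. *)
Lemma gpush_conj (K : fieldType) (G : finGroupType) (u : galg K G) g :
  gelt K g * gpush (fun x => x ^ g)%g u = u * gelt K g.
Proof.
rewrite /gpush /glin mulr_sumr [in RHS](gelt_sum u) mulr_suml.
by apply: eq_bigr => x _; rewrite -scalerAl -scalerAr -!geltM [in RHS]conjgC.
Qed.

Section WreathTwist.
Variables (k : fieldType) (p : nat) (z : k).
Hypotheses (p_prime : prime p) (z_prim : p.-primitive_root z) (np : p%:R != 0
  :> k).
Local Notation V := (galg 'F_p 'Z_p).
Local Notation G := (wreath 'F_p 'Z_p).
Local Notation ze := (zeta_exp z).

Definition base_pairing (x v : V) : k := ze (dot x v).

Lemma biadditive_bicharacter (f : V -> V -> 'F_p) :
  (forall x y v, f (x + y) v = f x v + f y v) ->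
  (forall x v w, f x (v + w) = f x v + f x w) ->
    bicharacter (fun x y => ze (f x y)).
Proof.
move=> fDl fDr; split=> [x y v|]; last split=> [x y v|x y].
- by rewrite -(zeta_expD p_prime z_prim) -fDl.
- by rewrite -(zeta_expD p_prime z_prim) -fDr.
- exact: zeta_exp_neq0 p_prime z_prim _.
Qed.

Lemma base_pairing_perfect : perfect base_pairing.
Proof.
have l x : (forall v, base_pairing x v = 1) -> x = 1%g.
  move=> x1; apply/ffunP=> c; have := x1 (gelt 'F_p c).
  rewrite /base_pairing dot_gelt -(zeta_exp0 p z).
  by move/(zeta_exp_inj p_prime z_prim) ->; rewrite ffunE.
split=> //; first by apply: biadditive_bicharacter;
  [exact: dotDl | exact: dotDr].
by move=> v v1; apply: l => x; rewrite /base_pairing dotC; apply: v1.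
Qed.

Lemma card_base_neq0 : #|{: V}|%:R != 0 :> k.
Proof.
rewrite card_ffun natrX expf_neq0 // card_Fp //.
Qed.

Definition base_bichar (nu : 'Z_p -> 'F_p) (x y : V) : k := ze (circ_form nu x
  y).

Lemma base_bicharacter nu : bicharacter (base_bichar nu).
Proof.
by apply: biadditive_bicharacter; [exact: circ_formDl | exact:
  circ_formDr].
Qed.

Definition wreath_twist nu : galg k (G * G)%type :=
  gpush (@base_elt2 'F_p 'Z_p) (bichar_twist base_pairing (base_bichar nu)).

Let bpp := base_pairing_perfect.
Let nV := card_base_neq0.

Lemma wreath_twistD nu nu' :
  wreath_twist (fun c => nu c + nu' c) = wreath_twist nu * wreath_twist nu'.
Proof.
rewrite /wreath_twist -(gpushM (@base_elt2M _ _)) (bichar_twistM bpp nV).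
congr gpush; apply: (eq_bichar_twist bpp nV) => x y.
by rewrite /base_bichar circ_formD (zeta_expD p_prime z_prim).
Qed.

Lemma eq_wreath_twist nu nu' : nu =1 nu' -> wreath_twist nu = wreath_twist nu'.
Proof.
move=> e; congr gpush; apply: (eq_bichar_twist bpp nV) => x y.
by rewrite /base_bichar (eq_circ_form e).
Qed.

Lemma wreath_twist0 : wreath_twist (fun=> 0) = 1.
Proof.
have e1 : gpush (@base_elt2 'F_p 'Z_p) 1 = 1 :> galg k (G * G)%type.
  by apply: gpush1; rewrite /base_elt2 /= base_elt0.
rewrite /wreath_twist -[RHS]e1 -(bichar_twist1 bpp nV); congr gpush;
  apply: (eq_bichar_twist bpp nV) => x y.
rewrite /base_bichar /circ_form big1 ?expr0 // => c _; rewrite big1 // => d _.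
by rewrite mulr0.
Qed.

Lemma wreath_twist_twist nu : twist (wreath_twist nu).
Proof.
apply: (gpush_twist (@base_eltM 'F_p 'Z_p)).
exact: (bichar_twist_twist bpp nV (base_bicharacter nu)).
Qed.

(** Conjugation by an element with top component c acts on [V] as translation by c^-1. Its adjoint
    for [dot] is translation by c, which preserves [circ_form]. *)
Lemma wreath_twist_invariant nu : Defs.invariant (wreath_twist nu).
Proof.
apply: invariant_gelt => g; rewrite comul_gelt.
rewrite -[RHS]gpush_conj; congr (_ * _); have [c [v ->]] := wreathE g.
rewrite /wreath_twist gpush_comp.
pose s (w : V) := gelt 'F_p c^-1%g * w; pose t (x : V) := gelt 'F_p c * x.
have adj x w : base_pairing x (s w) = base_pairing (t x) w.
  by rewrite /base_pairing dot_translate.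
rewrite -[in LHS](bichar_twist_push bpp nV adj (b := base_bichar nu));
  last first.
  by move=> x y; rewrite /base_bichar circ_form_translate.
rewrite gpush_comp; apply: eq_gpush => -[x y] /=.
by congr (_, _); rewrite /s -(base_conj v).
Qed.

Lemma wreath_twist_invtwist nu : invtwist (wreath_twist nu).
Proof.
by split; [exact: wreath_twist_twist | exact: wreath_twist_invariant].
Qed.

(** Symmetry at the pair of basis elements (c, 1) gives nu(c) = nu(c^-1) = - nu(c), so 2 nu(c) =
    0. *)
Lemma wreath_twist_symmetric nu : odd p -> (forall c, nu c^-1%g = - nu c) ->
  gswap (wreath_twist nu) = wreath_twist nu -> forall c, nu c = 0.
Proof.
move=> p_odd nuV sym c.
have /(bichar_twist_inj bpp nV) e : bichar_twist base_pairing (fun x y =>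
  base_bichar nu y x) =
    bichar_twist base_pairing (base_bichar nu).
  rewrite -(gswap_bichar_twist bpp nV); move: sym; rewrite /wreath_twist.
  move: (bichar_twist _ _) => f sym; apply/ffunP=> x.
  rewrite -(gpush_injE _ x (@base_elt2_inj _ _)) -[in RHS](gpush_injE _ x
    (@base_elt2_inj _ _)).
  by rewrite -[in RHS]sym /gswap !gpush_comp; congr (_ _); apply: eq_gpush.
have := e (gelt 'F_p c) (gelt 'F_p 1%g); rewrite /base_bichar !circ_form_gelt.
move/(zeta_exp_inj p_prime z_prim); rewrite invg1 mul1g mulg1 nuV => /eqP.
rewrite -subr_eq0 opprK -mulr2n -mulr_natl mulf_eq0.
by rewrite (negPf (two_neq0 p_prime p_odd)) => /eqP.
Qed.

End WreathTwist.

(** * Symmetrization of invariant twists *)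

Section Symmetrization.
Variables (k : fieldType) (p : nat) (z : k).
Hypotheses (p_prime : prime p) (z_prim : p.-primitive_root z) (np : p%:R != 0
  :> k).
Hypothesis p_odd : odd p.
Local Notation V := (galg 'F_p 'Z_p).
Local Notation G := (wreath 'F_p 'Z_p).
Local Notation ze := (zeta_exp z).
Local Notation bpair := (@base_pairing k p z).
Let bpp := base_pairing_perfect p_prime z_prim.
Let nV := card_base_neq0 p_prime np.

Lemma base_gpush_inj : injective (@gpush k _ _ (@base_elt2 'F_p 'Z_p)).
Proof.
move=> u v /ffunP e; apply/ffunP=> x; have := e (base_elt2 x).
by rewrite !gpush_injE //; exact: base_elt2_inj.
Qed.

Lemma gswap_base_gpush (u : galg k (V * V)%type) :
  gswap (gpush (@base_elt2 'F_p 'Z_p) u) = gpush (@base_elt2 'F_p 'Z_p) (gswap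
    u).
Proof. by rewrite /gswap !gpush_comp; apply: eq_gpush. Qed.

Lemma rmatrix_circulant (T : galg k (G * G)%type) : invtwist T ->
  exists2 nu : 'Z_p -> 'F_p, forall c, nu c^-1%g = - nu c &
    rmatrix T = gpush (@base_elt2 'F_p 'Z_p) (bichar_twist bpair (base_bichar z
      nu)).
Proof.
move=> iT; have [r [rE rl rr]] := rmatrix_descent (two_neq0 p_prime p_odd) iT.
have b1 : gpush (@base_elt2 'F_p 'Z_p) 1 = 1 :> galg k (G * G)%type.
  by apply: gpush1; rewrite /base_elt2 /= base_elt0.
have rsr : r * gswap r = 1.
  apply: base_gpush_inj; rewrite (gpushM (@base_elt2M _ _)) -gswap_base_gpush
    -rE b1.
  exact: rmatrix_swapr.
have srr : gswap r * r = 1.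
  by apply: (can_inj (@gswapK _ _)); rewrite gswapM gswapK rsr [RHS]gpush1.
have Ur : r \is a GRing.unit by apply/unitrP; exists (gswap r).
pose b x y := fourier (pairing_prod bpair bpair) r (x, y).
have [bMl [bMr bnz]] : bicharacter b := fourier_character bpp rl rr Ur.
have rb : r = bichar_twist bpair b.
  by apply: (bichar_twist_uniq bpp nV) => -[x y].
(* The transform turns [r * gswap r = 1] into skew-symmetry of [b]. *)
have bC x y : b x y * b y x = 1.
  have := rsr; rewrite rb (gswap_bichar_twist bpp nV) (bichar_twistM bpp nV).
  rewrite -(bichar_twist1 bpp nV) => /(bichar_twist_inj bpp nV); exact.
(* As p kills [V], the values of [b] are p-th roots of unity and so have exponents in ['F_p]. *)
have bp x y : b x y ^+ p = 1.
  have bX i : b x y ^+ i = b (x *+ i) y.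
    elim: i => [|i IHi]; first by rewrite mulr0n (bichar1l (conj bMl (conj bMr
      bnz))).
    by rewrite exprS IHi mulrS -bMl.
  rewrite bX -scaler_nat (pcharf0 (pchar_Fp p_prime)) scale0r.
  exact: (bichar1l (conj bMl (conj bMr bnz))).
have /fin_all_exists[n nE] (x : V) : exists m : V ->
  'F_p, forall y, b x y = ze (m y).
  have /fin_all_exists[m mE] (y : V) : exists i : 'F_p, b x y = ze i.
    exact: zeta_exp_surj.
  by exists m.
have ze_inj := zeta_exp_inj p_prime z_prim.
have zeD := zeta_expD p_prime z_prim.
have nDl x y v : n (x + y) v = n x v + n y v.
  by apply: ze_inj; rewrite zeD -!nE -bMl.
have nDr x v w : n x (v + w) = n x v + n x w.
  by apply: ze_inj; rewrite zeD -!nE -bMr.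
have nC x y : n y x = - n x y.
  apply/eqP; rewrite -addr_eq0; apply/eqP/ze_inj.
  by rewrite zeD -!nE bC zeta_exp0.
(* Invariance of the R-matrix under conjugation by [top_elt c] is invariance of [r] under
   translation by c^-1, which passes through the adjoint to the exponent [n]. *)
have nJ c x y : n (gelt 'F_p c * x) (gelt 'F_p c * y) = n x y.
  apply: ze_inj; rewrite -!nE /b.
  pose s (w : V) := gelt 'F_p c^-1%g * w; pose t (w : V) := gelt 'F_p c * w.
  have stK : cancel t s by move=> w; rewrite /s /t mulrA -geltM mulVg mul1r.
  have tsK : cancel s t by move=> w; rewrite /s /t mulrA -geltM mulgV mul1r.
  pose s2 (w : V * V) := (s w.1, s w.2).
  have s2I : injective s2.
    by move=> [v w] [v' w'] [/(can_inj tsK)-> /(can_inj tsK)->].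
  have r_s v w : r (s v, s w) = r (v, w).
    have := rmatrix_conj iT (base_elt v) (base_elt w) (top_elt 'F_p c).
    rewrite rE !base_conj_top => e.
    have I := @base_elt2_inj 'F_p 'Z_p.
    by rewrite -(gpush_injE r (s v, s w) I) -(gpush_injE r (v, w) I).
  have s2r : gpush s2 r = r.
    apply/ffunP=> -[v w].
    have -> : (v, w) = s2 (t v, t w) by rewrite /s2 /= !stK.
    by rewrite gpush_injE // r_s.
  rewrite -[in RHS]s2r (@fourier_push _ _ _ (pairing_prod bpair bpair) _ _ (fun
    x => (t x.1, t x.2))) //.
  by move=> w; rewrite /pairing_prod /base_pairing /= !dot_translate.
pose nu c := n (gelt 'F_p 1%g) (gelt 'F_p c).
have nuE c d : n (gelt 'F_p c) (gelt 'F_p d) = nu (c^-1 * d)%g.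
  by rewrite -(nJ c^-1%g) -!geltM mulVg.
exists nu.
  by move=> c; rewrite /nu nC nuE invgK mulg1.
rewrite rE rb; congr gpush; apply: (eq_bichar_twist bpp nV) => x y.
by rewrite nE (circ_form_uniq nDl nDr nuE).
Qed.

(** Let J_h be the wreath twist with exponent h = nu / 2. The R-matrix R of [T] is J_{2h}, so
    swapping J_h T gives J_{-h} R T = J_{-h} J_{2h} T = J_h T. *)
Lemma twist_symmetrization (T : galg k (G * G)%type) : invtwist T ->
  exists2 nu : 'Z_p -> 'F_p, forall c, nu c^-1%g = - nu c &
    gswap (wreath_twist z nu * T) = wreath_twist z nu * T.
Proof.
move=> iT; have [nu nuV RE] := rmatrix_circulant iT.
pose h c := nu c / 2%:R; have hV c : h c^-1%g = - h c by rewrite /h nuV mulNr.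
have nuh c : nu c = h c + h c.
  by rewrite -mulr2n -mulr_natr divfK // (two_neq0 p_prime p_odd).
exists h => //; rewrite gswapM -(rmatrixK iT) mulrA; congr (_ * _).
rewrite RE /wreath_twist gswap_base_gpush -(gpushM (@base_elt2M _ _)).
rewrite (gswap_bichar_twist bpp nV) (bichar_twistM bpp nV).
congr gpush; apply: (eq_bichar_twist bpp nV) => x y.
rewrite /base_bichar -(zeta_expD p_prime z_prim) (circ_form_swap _ _ hV).
by rewrite (eq_circ_form nuh) circ_formD addKr.
Qed.

End Symmetrization.

Lemma gswap_comul (K : fieldType) (G : finGroupType) (a : galg K G) :
  gswap (comul a) = comul a.
Proof. by rewrite comul_push /gswap gpush_comp. Qed.

Lemma gswap_delta1 (K : fieldType) (G : finGroupType) (a : galg K G) :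
  gswap (delta1 a) = delta1 a.
Proof.
rewrite /delta1 gswapM gswap_comul; congr (_ * _).
by apply/ffunP=> -[g h]; rewrite gswapE !ffunE mulrC.
Qed.

(** The rank predicate asks for a homomorphism out of [H], whereas the construction gives one into
    it; the inverse is obtained by choice. *)
Lemma elementary_abelian_of_bij (p r : nat) (E : finGroupType) (H : groupType)
    (f : E -> H) : {morph f : x y / (x * y)%g} -> injective f ->
  (forall x, exists u, f u = x) ->
  (p.-abelem [set: E])%g -> ('r([set: E]) = r)%g ->
    elementary_abelian_of_rank p r H.
Proof.
move=> fM fI f_surj abE rE.
have f_surjb x : exists u, f u == x by have [u <-] := f_surj x; exists u.
pose g x := xchoose (f_surjb x).
have gK : cancel g f by move=> x; apply/eqP/(xchooseP (f_surjb x)).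
have fK : cancel f g by move=> u; apply: fI; rewrite gK.
have gM : {morph g : x y / (x * y)%g}.
  by move=> x y; rewrite -[x]gK -[y]gK -fM !fK.
pose gm := isMultiplicative.Build _ _ g gM.
pose g' : {multiplicative H -> E} := HB.pack g gm.
by exists E, g'; split=> //; exists f.
Qed.

Theorem proposition7p2 (k : closedFieldType) (p : nat)
    (k_char0 : [pchar k]%R =i pred0) (p_prime : prime p) (p_odd : odd p) :
  elementary_abelian_of_rank p ((p - 1) %/ 2) (lazyH2 k (wreath 'F_p 'Z_p)).
Proof.
have np : p%:R != 0 :> k.
  by have := k_char0 p; rewrite !inE p_prime /= => ->.
have [z z_prim] := prime_prim_root p_prime np.
pose X u := mkZ2 (wreath_twist_invtwist p_prime z_prim np (@odd_ext p u)).
have XD u v : X (u + v) = (X u * X v)%g.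
  apply: val_inj; rewrite /= -(wreath_twistD p_prime z_prim np).
  by apply: eq_wreath_twist => // c; rewrite odd_extD.
pose f (u : 'rV['F_p]_(half_order p)) : lazyH2 k (wreath 'F_p 'Z_p) :=
  \pi_(lazyH2 k (wreath 'F_p 'Z_p))%qT (X u).
apply: (@elementary_abelian_of_bij _ _ 'rV['F_p]_(half_order p) (lazyH2 k
  (wreath 'F_p 'Z_p)) f).
- by move=> u v; rewrite /f -[(u * v)%g]/(u + v) XD; apply/esym/pi_lazyH2_mul.
(* If [u] and [v] have the same class, the twist with exponent [odd_ext (u - v)] is a coboundary,
   hence symmetric. *)
- move=> u v /lazyH2P/asboolP[a [_ Za] aE].
  apply/eqP; rewrite -subr_eq0; apply/eqP; apply: (odd_ext_inj p_prime p_odd).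
  apply: (wreath_twist_symmetric p_prime z_prim np p_odd);
    first exact: odd_extV.
  have Xuv : X (u - v) = (X u * (X v)^-1)%g.
    by apply: (canRL (mulgK _)); rewrite -XD subrK.
  have -> : wreath_twist z (odd_ext (u - v)) = delta1 a by rewrite -aE -Xuv.
  exact: gswap_delta1.
- move=> x; have [T ->] := lazyH2W x.
  have [nu nuV sT] := twist_symmetrization p_prime z_prim np p_odd (lazyZ2P T).
  pose Y := mkZ2 (wreath_twist_invtwist p_prime z_prim np nu).
  have D : (Y * T)%g \in @lazyB2 k (wreath 'F_p 'Z_p).
    have [tYT iYT] := lazyZ2P (Y * T)%g; apply/asboolP.
    by apply: symmetric_twist_coboundary => // phi;
      exact: class_preserving_inner.
  (* As [Y * T] is a coboundary, the class of [T] is that of the inverse of [Y]; hence the sign of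
     the exponent. *)
  have [u uE] := odd_ext_surj p_prime p_odd (nu := fun c => - nu c)
    (fun c => congr1 -%R (nuV c)).
  exists u; apply/lazyH2P.
  have XY : (X u * Y)%g = 1%g.
    apply: val_inj; rewrite /= -(wreath_twistD p_prime z_prim np).
    rewrite -[RHS](wreath_twist0 p_prime z_prim np).
    by apply: eq_wreath_twist => // c; rewrite uE addNr.
  have -> : X u = (T * (Y * T)^-1)%g.
    by rewrite invgM mulKVg; apply: (mulIg Y); rewrite XY mulVg.
  by rewrite -(lazyB2_central T (lazyB2V D)) mulgK; exact: lazyB2V.
- exact: mx_Fp_abelem.
- by rewrite (rank_abelem (mx_Fp_abelem _ _ p_prime)) cardsT card_mx card_Fp //
    mul1n pfactorK.
Qed.
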